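(* Let $\alpha\in\ell^2$ and $1<q<\infty$. The Rhaly operator $R_\alpha$ belongs to the Schatten class $\mathcal{S}^q(\ell^2)$ if and only if the sequence $(\sigma_k)_k$ belongs to $\ell^q$.
   Context: $\mathbb{N}=\{0,1,2,\dots\}$; $(R_\alpha f)(k)=\alpha_k\sum_{j=0}^kf(j)$ on $\ell^2$ (square-summable functions $\mathbb{N}\to\mathbb{C}$). $\sigma_k=(\sum_{j=2^k}^{2^{k+1}-1}(j+1)|\alpha_j|^2)^{1/2}$ for $k\in\mathbb{N}$ (and $\sigma_{-1}=|\alpha_0|$). $T\in\mathcal{S}^q(\ell^2)$ means $(a_n(T))_{n\ge1}\in\ell^q$, where $a_{n+1}(T)=\inf\{\|T-P\|:\operatorname{rank}P\le n\}$. *)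

(* Defs.v *)
From Stdlib Require Import Reals.
From Coquelicot Require Import Coquelicot.
Open Scope R_scope.

Fixpoint csum (n : nat) (h : nat -> C) : C :=
  match n with O => 0%C | S m => Cplus (csum m h) (h m) end.

(* real power x^q with the convention 0^q = 0 (q > 0), x >= 0 *)
Definition rpow (x q : R) : R := if Rle_dec x 0 then 0 else Rpower x q.

Definition in_l2 (f : nat -> C) : Prop := ex_series (fun n => (Cmod (f n))^2).

(* l^2 norm, in Rbar (p_infty if f is not square-summable) *)
Definition l2norm (f : nat -> C) : Rbar :=
  match Lim_seq (fun n => sum_n (fun k => (Cmod (f k))^2) n) with
  | Finite x => Finite (sqrt x)
  | p_infty => p_infty
  | m_infty => m_infty
  end.

(* operators are maps of sequences; only their action on l^2 matters *)
Definition op := (nat -> C) -> (nat -> C).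

Definition op_sub (T P : op) : op := fun f k => Cminus (T f k) (P f k).

Definition opnorm (T : op) : Rbar :=
  Lub_Rbar (fun r => exists f, in_l2 f /\ Rbar_le (l2norm f) 1 /\
                              Rbar_le (Finite r) (l2norm (T f))).

Definition linear_l2 (P : op) : Prop :=
  (forall f g, in_l2 f -> in_l2 g ->
     P (fun k => Cplus (f k) (g k)) = (fun k => Cplus (P f k) (P g k))) /\
  (forall (c : C) f, in_l2 f -> P (fun k => Cmult c (f k)) = (fun k => Cmult c (P f k))).

Definition bdd_rank_le (P : op) (n : nat) : Prop :=
  linear_l2 P /\ is_finite (opnorm P) /\
  exists v : nat -> (nat -> C),
    (forall i, in_l2 (v i)) /\
    forall f, in_l2 f -> exists c : nat -> C,
      P f = (fun k => csum n (fun i => Cmult (c i) (v i k))).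

(* approx T n = a_{n+1}(T) = inf { ||T - P|| : rank P <= n } *)
Definition approx (T : op) (n : nat) : Rbar :=
  Glb_Rbar (fun r => exists P, bdd_rank_le P n /\ Rbar_le (opnorm (op_sub T P)) (Finite r)).

Definition schatten (q : R) (T : op) : Prop :=
  (forall n, is_finite (approx T n)) /\
  ex_series (fun n => rpow (real (approx T n)) q).

Definition rhaly (alpha : nat -> C) : op :=
  fun f k => Cmult (alpha k) (csum (S k) f).

Definition sigma (alpha : nat -> C) (k : nat) : R :=
  sqrt (sum_n_m (fun j => (INR j + 1) * (Cmod (alpha j))^2) (2^k) (2^(S k) - 1)).

(* the sequence (sigma_k)_{k >= -1}, shifted: index 0 is sigma_{-1} = |alpha_0| *)
Definition sigma_seq (alpha : nat -> C) (m : nat) : R :=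
  match m with O => Cmod (alpha O) | S k => sigma alpha k end.

(* Main.v *)
(* Cut [nat] into the dyadic blocks [2^k, 2^(k+1)).

   Sufficiency.  Fix [t > 0] and call a block high if [sigma_k > t].  On the low rows the
   operator has norm O(t) by a dyadic Hardy inequality.  On the high rows subtract
   [alpha_j * sum_(i <= a) f i], where the anchor [a <= j] is moved to [j] as soon as
   [(j - a) * sum_(a < i <= j) |alpha_i|^2] exceeds [t^2]; by Cauchy-Schwarz the remainder has
   norm at most [t], and a high block contains at most [1 + sigma_k / t] anchors.  Hence
   [a_n <= 4 t] once [n >= 1 + sum_(sigma_k > t) 2 sigma_k / t]; with [t = 2^-J] and a
   summation over [J] this bounds [sum a_n^q] by a multiple of [1 + sum sigma_k^q], the condition
   [q > 1] entering through the geometric series of ratio [2^(1-q)].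

   Necessity.  In each residue class of block indices modulo 3 there are orthonormal test
   sequences of disjoint supports whose partial sums see exactly one block of the class, so that
   the operator is bounded below by [t / 3] on the span of those with [sigma_k >= t].  An
   operator of rank [n] kills a unit vector in the span of [n + 1] of them, so the [(n+1)]-st
   largest [sigma_k] of the class is at most [3 a_(n+1)]. *)
From Stdlib Require Import Reals Lra Lia List FunctionalExtensionality ClassicalEpsilon.
From Coquelicot Require Import Coquelicot.
Require Import Defs.
Open Scope R_scope.

(** * Finite sums and series of nonnegative reals *)

Fixpoint rsum (n : nat) (h : nat -> R) : R :=
  match n with O => 0 | S m => rsum m h + h m end.

Lemma rsum_ext n h g : (forall i, (i < n)%nat -> h i = g i) -> rsum n h = rsum n g.
Proof.
  induction n as [|n IH]; intros H; simpl; [easy|].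
  rewrite IH, (H n); auto with arith.
Qed.

Lemma rsum_le n h g : (forall i, (i < n)%nat -> h i <= g i) -> rsum n h <= rsum n g.
Proof.
  induction n as [|n IH]; intros H; simpl; [lra|].
  apply Rplus_le_compat; auto with arith.
Qed.

Lemma rsum_ge0 n h : (forall i, 0 <= h i) -> 0 <= rsum n h.
Proof. intros H; induction n as [|n IH]; simpl; [lra|]. specialize (H n); lra. Qed.

Lemma rsum_plus n h g : rsum n (fun i => h i + g i) = rsum n h + rsum n g.
Proof. induction n as [|n IH]; simpl; [ring|]. rewrite IH; ring. Qed.

Lemma rsum_scal n c h : rsum n (fun i => c * h i) = c * rsum n h.
Proof. induction n as [|n IH]; simpl; [ring|]. rewrite IH; ring. Qed.

Lemma rsum_swap n m (h : nat -> nat -> R) :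
  rsum n (fun i => rsum m (h i)) = rsum m (fun j => rsum n (fun i => h i j)).
Proof.
  induction n as [|n IH]; simpl.
  - induction m as [|m IH]; simpl; [easy|]. rewrite <- IH; ring.
  - now rewrite IH, rsum_plus.
Qed.

Lemma rsum_sub_le a b h g : (a <= b)%nat ->
  (forall j, (a <= j < b)%nat -> h j <= g j) -> rsum b h - rsum a h <= rsum b g - rsum a g.
Proof.
  intros ab; induction ab as [|b ab IH]; intros H; simpl; [lra|].
  assert (rsum b h - rsum a h <= rsum b g - rsum a g) by (apply IH; intros; apply H; lia).
  assert (h b <= g b) by (apply H; lia). lra.
Qed.

Lemma rsum_mono a b h : (forall i, 0 <= h i) -> (a <= b)%nat -> rsum a h <= rsum b h.
Proof.
  intros H ab; induction ab as [|b ab IH]; simpl; [lra|]. specialize (H b); lra.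
Qed.

(** Charging [INR m] terms instead of [m - n] keeps the bound valid for [m < n] as well, where the
    consecutive cut points of the level argument may be out of order. *)
Lemma rsum_le_tail n m c h : 0 <= c -> (forall i, 0 <= h i) ->
  (forall i, (n <= i < m)%nat -> h i <= c) -> rsum m h <= rsum n h + INR m * c.
Proof.
  intros c0 h0 H; induction m as [|m IH].
  - simpl. assert (0 <= rsum n h) by now apply rsum_ge0. lra.
  - destruct (Nat.lt_ge_cases m n) as [mn|nm].
    + assert (rsum (S m) h <= rsum n h) by (apply rsum_mono; auto).
      assert (0 <= INR (S m) * c) by (apply Rmult_le_pos; auto using pos_INR). lra.
    + rewrite S_INR; simpl.
      assert (h m <= c) by (apply H; lia).
      assert (rsum m h <= rsum n h + INR m * c) by (apply IH; intros; apply H; lia). lra.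
Qed.

Lemma sum_n_rsum (h : nat -> R) n : sum_n h n = rsum (S n) h.
Proof.
  induction n as [|n IH]; [rewrite sum_O; symmetry; apply Rplus_0_l|].
  now rewrite sum_Sn, IH.
Qed.

Lemma sum_n_m_rsum (h : nat -> R) a b : (a <= S b)%nat -> sum_n_m h a b = rsum (S b) h - rsum a h.
Proof.
  intros ab; destruct (Nat.eq_dec a (S b)) as [->|ne].
  - rewrite sum_n_m_zero by lia. change (0 = rsum (S b) h - rsum (S b) h); ring.
  - assert (ab' : (a <= b)%nat) by lia; clear ab ne.
    induction ab' as [|b ab IH].
    + rewrite sum_n_n. change (h a = rsum a h + h a - rsum a h); ring.
    + rewrite sum_n_Sm by lia. rewrite IH.
      change (rsum (S b) h - rsum a h + h (S b) = rsum (S b) h + h (S b) - rsum a h); ring.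
Qed.

Lemma ex_series_bounded (h : nat -> R) B : (forall i, 0 <= h i) -> (forall n, rsum n h <= B) -> ex_series h.
Proof.
  intros h0 H.
  destruct (ex_finite_lim_seq_incr (sum_n h) B) as [l Hl].
  - intros n; rewrite sum_Sn; specialize (h0 (S n)).
    change (sum_n h n <= sum_n h n + h (S n)); lra.
  - intros n; rewrite sum_n_rsum; apply H.
  - now exists l.
Qed.

Lemma rsum_le_Series (h : nat -> R) n : (forall i, 0 <= h i) -> ex_series h -> rsum n h <= Series h.
Proof.
  intros h0 H. apply Rle_trans with (sum_n h n).
  - rewrite sum_n_rsum; simpl; specialize (h0 n); lra.
  - apply (is_lim_seq_incr_compare (sum_n h) (Series h)).
    + apply Series_correct, H.
    + intros k; rewrite sum_Sn; specialize (h0 (S k)).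
      change (sum_n h k <= sum_n h k + h (S k)); lra.
Qed.

(** * Norms *)

Definition sq (f : nat -> C) (k : nat) : R := (Cmod (f k))^2.

Lemma sq_ge0 f k : 0 <= sq f k.
Proof. apply pow2_ge_0. Qed.

(** The partial sums are nondecreasing, so the limit exists in [Rbar] even when [f] is not
    square-summable, and the case [m_infty] of [l2norm] cannot occur. *)
Lemma l2_lim f : exists l, is_lim_seq (fun n => sum_n (sq f) n) l /\
  Lim_seq (fun n => sum_n (fun k => (Cmod (f k))^2) n) = l /\ Rbar_le 0 l.
Proof.
  assert (H : ex_lim_seq (fun n => sum_n (sq f) n)).
  { apply ex_lim_seq_incr; intros n; rewrite sum_Sn; generalize (sq_ge0 f (S n)); intro.
    change (sum_n (sq f) n <= sum_n (sq f) n + sq f (S n)); lra. }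
  destruct H as [l Hl]; exists l; split; [easy|split].
  - now apply is_lim_seq_unique.
  - apply (is_lim_seq_le (fun _ => 0) (fun n => sum_n (sq f) n)); auto.
    + intros n; rewrite sum_n_rsum; apply rsum_ge0, sq_ge0.
    + apply is_lim_seq_const.
Qed.

(** Together with [l2norm_le_inv], this trades norms in [Rbar] for uniform bounds on finite sums,
    the form in which all later estimates are made. *)
Lemma l2norm_le f r : 0 <= r -> (forall n, rsum n (sq f) <= r^2) -> Rbar_le (l2norm f) r.
Proof.
  intros r0 H; destruct (l2_lim f) as [l [Hl [E l0]]].
  unfold l2norm; rewrite E.
  assert (L : Rbar_le l (r^2)).
  { apply (is_lim_seq_le (fun n => sum_n (sq f) n) (fun _ => r^2)); auto.
    - intros n; rewrite sum_n_rsum; apply H.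
    - apply is_lim_seq_const. }
  destruct l as [x| |]; simpl in *; try easy.
  rewrite <- (sqrt_pow2 r) by easy. now apply sqrt_le_1_alt.
Qed.

Lemma l2norm_le_inv f r : 0 <= r -> Rbar_le (l2norm f) r -> forall n, rsum n (sq f) <= r^2.
Proof.
  intros r0 H n; destruct (l2_lim f) as [l [Hl [E l0]]].
  unfold l2norm in H; rewrite E in H.
  destruct l as [x| |]; simpl in H, l0; try easy.
  apply Rle_trans with x.
  - apply Rle_trans with (sum_n (sq f) n).
    + rewrite sum_n_rsum; simpl; generalize (sq_ge0 f n); lra.
    + apply (is_lim_seq_incr_compare (fun n => sum_n (sq f) n) x); auto.
      intros k; rewrite sum_Sn; generalize (sq_ge0 f (S k)); intro.
      change (sum_n (sq f) k <= sum_n (sq f) k + sq f (S k)); lra.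
  - rewrite <- (pow2_sqrt x) by easy. apply pow_incr; split; [apply sqrt_pos|easy].
Qed.

Lemma l2norm_ge0 f : Rbar_le 0 (l2norm f).
Proof.
  destruct (l2_lim f) as [l [Hl [E l0]]].
  unfold l2norm; rewrite E.
  destruct l; simpl in *; try easy. apply sqrt_pos.
Qed.

Lemma in_l2_bounded f B : (forall n, rsum n (sq f) <= B) -> in_l2 f.
Proof. intros H; apply (ex_series_bounded (sq f) B); [apply sq_ge0|easy]. Qed.

Lemma in_l2_zero : in_l2 (fun _ => 0%C).
Proof.
  apply (in_l2_bounded _ 0); intros n; induction n as [|n IH]; simpl; [lra|].
  unfold sq at 2; rewrite Cmod_0; lra.
Qed.

Lemma opnorm_ge0 T : Rbar_le 0 (opnorm T).
Proof.
  unfold opnorm. apply (proj1 (Lub_Rbar_correct _)).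
  exists (fun _ => 0%C); repeat split.
  - apply in_l2_zero.
  - apply l2norm_le; [lra|]. intros n.
    induction n as [|n IH]; simpl; [lra|].
    simpl in IH; unfold sq at 2; rewrite Cmod_0; lra.
  - apply l2norm_ge0.
Qed.

Lemma opnorm_le T c : 0 <= c ->
  (forall f F n, in_l2 f -> 0 <= F -> (forall m, rsum m (sq f) <= F) ->
     rsum n (sq (T f)) <= c^2 * F) -> Rbar_le (opnorm T) c.
Proof.
  intros c0 H. apply (proj2 (Lub_Rbar_correct _)).
  intros r [f [f2 [f1 Hr]]].
  apply Rbar_le_trans with (1 := Hr).
  apply l2norm_le; [easy|]. intros n.
  replace (c^2) with (c^2 * 1^2) by ring.
  apply H; try easy; [lra|]. apply l2norm_le_inv; [lra|easy].
Qed.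

Lemma opnorm_le_inv T r f : 0 <= r -> Rbar_le (opnorm T) r -> in_l2 f ->
  (forall m, rsum m (sq f) <= 1) -> forall n, rsum n (sq (T f)) <= r^2.
Proof.
  intros r0 H f2 f1. apply l2norm_le_inv; [easy|].
  assert (f1' : Rbar_le (l2norm f) 1) by (apply l2norm_le; [lra|]; intro m; simpl; rewrite !Rmult_1_r; apply f1).
  assert (U : forall x : R, Rbar_le x (l2norm (T f)) -> x <= r).
  { intros x Hx. assert (Rbar_le x (opnorm T)).
    - apply (proj1 (Lub_Rbar_correct _)). now exists f.
    - exact (Rbar_le_trans _ _ _ H0 H). }
  generalize (l2norm_ge0 (T f)); destruct (l2norm (T f)) as [x| |]; simpl in *; intros; try easy.
  - apply U; lra.
  (* An infinite norm would put [r + 1] into the set whose least upper bound is at most [r]. *)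
  - assert (r + 1 <= r) by now apply U. lra.
Qed.

Lemma opnorm_finite T c : Rbar_le (opnorm T) (Finite c) -> is_finite (opnorm T).
Proof.
  generalize (opnorm_ge0 T); destruct (opnorm T); simpl; easy.
Qed.

Lemma approx_ge0 T n : Rbar_le 0 (approx T n).
Proof.
  apply (proj2 (Glb_Rbar_correct _)). intros r [P [_ H]].
  exact (Rbar_le_trans _ _ _ (opnorm_ge0 _) H).
Qed.

Lemma approx_le T n P (r : R) : bdd_rank_le P n -> Rbar_le (opnorm (op_sub T P)) r ->
  is_finite (approx T n) /\ real (approx T n) <= r.
Proof.
  intros H1 H2.
  assert (U : Rbar_le (approx T n) r).
  { apply (proj1 (Glb_Rbar_correct _)). now exists P. }
  generalize (approx_ge0 T n); destruct (approx T n); simpl in *; easy.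
Qed.

Lemma le_approx T n (t : R) : is_finite (approx T n) ->
  (forall P r, bdd_rank_le P n -> 0 <= r -> Rbar_le (opnorm (op_sub T P)) (Finite r) -> t <= r) ->
  t <= real (approx T n).
Proof.
  intros fin H.
  assert (U : Rbar_le t (approx T n)).
  { apply (proj2 (Glb_Rbar_correct _)). intros r [P [H1 H2]]; simpl.
    apply (H P r); auto.
    exact (Rbar_le_trans _ _ _ (opnorm_ge0 _) H2). }
  rewrite <- fin in U; exact U.
Qed.

(** Cauchy-Schwarz for pairs: [(x y)^2 <= (X Y') (X' Y)], and the geometric mean of [X Y'] and
    [X' Y] is at most their arithmetic mean. It is the induction step of every estimate of the form
    length times mass. *)
Lemma sq_add_le_mul_add x y X Y X' Y' :
  0 <= x -> 0 <= y -> 0 <= X -> 0 <= Y -> 0 <= X' -> 0 <= Y' ->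
  x^2 <= X * Y -> y^2 <= X' * Y' -> (x + y)^2 <= (X + X') * (Y + Y').
Proof.
  intros x0 y0 X0 Y0 X0' Y0' Hx Hy.
  assert (H : (x * y)^2 <= ((X * Y' + X' * Y) / 2)^2).
  { rewrite Rpow_mult_distr.
    apply Rle_trans with ((X * Y) * (X' * Y')).
    - apply Rmult_le_compat; auto; apply pow2_ge_0.
    - assert (0 <= (X * Y' - X' * Y)^2) by apply pow2_ge_0. nra. }
  assert (0 <= X * Y') by now apply Rmult_le_pos.
  assert (0 <= X' * Y) by now apply Rmult_le_pos.
  assert (x * y <= (X * Y' + X' * Y) / 2).
  { apply Rsqr_incr_0_var; [|lra]. unfold Rsqr; simpl in H; lra. }
  nra.
Qed.

(** * Partial sums *)

Lemma csum_ext n (h g : nat -> C) : (forall i, (i < n)%nat -> h i = g i) -> csum n h = csum n g.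
Proof.
  induction n as [|n IH]; intros H; simpl; [easy|].
  rewrite IH, (H n); auto with arith.
Qed.

Lemma csum_zero n (h : nat -> C) : (forall i, (i < n)%nat -> h i = 0%C) -> csum n h = 0%C.
Proof.
  intros H; induction n as [|n IH]; simpl; [easy|].
  rewrite IH, (H n) by auto with arith. ring.
Qed.

Lemma csum_plus n h g : csum n (fun i => Cplus (h i) (g i)) = Cplus (csum n h) (csum n g).
Proof. induction n as [|n IH]; simpl; [ring|]. rewrite IH; ring. Qed.

Lemma csum_scal n c h : csum n (fun i => Cmult c (h i)) = Cmult c (csum n h).
Proof. induction n as [|n IH]; simpl; [ring|]. rewrite IH; ring. Qed.

Lemma csum_swap n m (h : nat -> nat -> C) :
  csum n (fun i => csum m (h i)) = csum m (fun j => csum n (fun i => h i j)).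
Proof.
  induction n as [|n IH]; simpl.
  - induction m as [|m IH]; simpl; [easy|]. rewrite <- IH; ring.
  - now rewrite IH, csum_plus.
Qed.

Lemma csum_delta n m (h : nat -> C) : (m < n)%nat ->
  (forall i, (i < n)%nat -> i <> m -> h i = 0%C) -> csum n h = h m.
Proof.
  intros mn; induction mn as [|n mn IH]; intros H; simpl.
  - rewrite csum_zero; [ring|]. intros; apply H; lia.
  - rewrite IH by (intros; apply H; lia). rewrite (H n) by lia. ring.
Qed.

Lemma csum_sub_sq_le a b f : (a <= b)%nat ->
  (Cmod (csum b f - csum a f))^2 <= INR (b - a) * (rsum b (sq f) - rsum a (sq f)).
Proof.
  intros ab; induction ab as [|b ab IH].
  - replace (csum a f - csum a f)%C with (RtoC 0) by ring. rewrite Cmod_0; simpl; nra.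
  - replace (S b - a)%nat with (S (b - a)) by lia. rewrite S_INR. simpl csum; simpl rsum.
    replace (csum b f + f b - csum a f)%C with (csum b f - csum a f + f b)%C by ring.
    replace (rsum b (sq f) + sq f b - rsum a (sq f))%R
      with (rsum b (sq f) - rsum a (sq f) + sq f b)%R by ring.
    apply Rle_trans with ((Cmod (csum b f - csum a f) + Cmod (f b))^2).
    + apply pow_incr; split; [apply Cmod_ge_0|apply Cmod_triangle].
    + assert (M := rsum_mono a b (sq f) (sq_ge0 f) ab).
      apply sq_add_le_mul_add; try apply Cmod_ge_0; try apply pos_INR; try apply sq_ge0; try lra.
      unfold sq; lra.
Qed.

Lemma csum_sq_le b f : (Cmod (csum b f))^2 <= INR b * rsum b (sq f).
Proof.
  generalize (csum_sub_sq_le 0 b f (Nat.le_0_l b)); simpl csum; simpl rsum.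
  replace (csum b f - 0)%C with (csum b f) by ring.
  now rewrite Nat.sub_0_r, Rminus_0_r.
Qed.

Lemma rsum_sub_sq_le a b h : (forall i, 0 <= h i) -> (a <= b)%nat ->
  (rsum b h - rsum a h)^2 <= INR (b - a) * (rsum b (fun i => h i ^ 2) - rsum a (fun i => h i ^ 2)).
Proof.
  intros h0 ab; induction ab as [|b ab IH].
  - rewrite !Rminus_diag; simpl; lra.
  - replace (S b - a)%nat with (S (b - a)) by lia. rewrite S_INR.
    assert (M := rsum_mono a b h h0 ab).
    assert (M2 := rsum_mono a b (fun i => h i ^ 2) (fun i => pow2_ge_0 _) ab).
    set (g := fun i => h i ^ 2) in *.
    change (rsum (S b) h) with (rsum b h + h b). change (rsum (S b) g) with (rsum b g + h b ^ 2).
    replace (rsum b h + h b - rsum a h) with (rsum b h - rsum a h + h b) by ring.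
    replace (rsum b g + h b ^ 2 - rsum a g) with (rsum b g - rsum a g + h b ^ 2) by ring.
    apply sq_add_le_mul_add; auto; try apply pos_INR; try apply pow2_ge_0; lra.
Qed.

Lemma Cmod_csum_le n f : Cmod (csum n f) <= rsum n (fun i => Cmod (f i)).
Proof.
  induction n as [|n IH]; simpl; [rewrite Cmod_0; lra|].
  generalize (Cmod_triangle (csum n f) (f n)); lra.
Qed.

(** * A dyadic Hardy inequality *)

Lemma INR_pow2 k : INR (2 ^ k) = 2 ^ k.
Proof. rewrite pow_INR; reflexivity. Qed.

Lemma pow2_gt0 k : 0 < 2 ^ k.
Proof. apply pow_lt; lra. Qed.

(* With [U_K = G_K^2 / 2^K], where [G_K] is the sum of the first [2^K] moduli, one has
   [U_(K+1) <= 3/4 U_K + 3/2 x] with [x] the mass of block [K]; the multiple [6] of [U_K] is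
   the one that absorbs the increment [2 tau U_(K+1)] of the left-hand side. *)
Lemma dyadic_hardy w tau f : (forall j, 0 <= w j) -> 0 <= tau -> w O <= tau ->
  (forall k, 2^k * (rsum (2^(S k)) w - rsum (2^k) w) <= tau) ->
  forall K, rsum (2^K) (fun j => w j * (Cmod (csum (S j) f))^2)
    + 6 * tau * ((rsum (2^K) (fun i => Cmod (f i)))^2 / 2^K) <= 12 * tau * rsum (2^K) (sq f).
Proof.
  intros w0 tau0 Hw0 Hw K.
  induction K as [|K IH].
  - change (2 ^ 0)%nat with 1%nat. simpl rsum. simpl csum. unfold sq.
    replace (0 + f O)%C with (f O) by ring.
    assert (0 <= (Cmod (f O))^2) by apply pow2_ge_0. simpl pow. simpl pow in H. nra.
  - set (n := (2 ^ K)%nat) in *. set (n' := (2 ^ S K)%nat).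
    assert (nn : (n <= n')%nat) by (apply Nat.pow_le_mono_r; lia).
    set (Q := fun j => w j * (Cmod (csum (S j) f))^2) in *.
    set (m := fun i => Cmod (f i)) in *.
    assert (m0 : forall i, 0 <= m i) by (intro; apply Cmod_ge_0).
    set (G := rsum n m) in *. set (G' := rsum n' m).
    assert (GG : G <= G') by now apply rsum_mono.
    assert (G0 : 0 <= G) by now apply rsum_ge0.
    (* On block [K] every partial sum of [f] is at most [G'] in modulus. *)
    assert (HQ : rsum n' Q - rsum n Q <= G'^2 * (rsum n' w - rsum n w)).
    { replace (G'^2 * (rsum n' w - rsum n w))
        with (rsum n' (fun j => G'^2 * w j) - rsum n (fun j => G'^2 * w j))
        by (rewrite !rsum_scal; ring).
      apply rsum_sub_le; [easy|]. intros j Hj. unfold Q.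
      rewrite Rmult_comm. apply Rmult_le_compat_r; auto.
      apply pow_incr; split; [apply Cmod_ge_0|].
      apply Rle_trans with (1 := Cmod_csum_le _ _). apply rsum_mono; auto with arith. lia. }
    assert (HY : (G' - G)^2 <= 2^K * (rsum n' (sq f) - rsum n (sq f))).
    { rewrite <- INR_pow2. replace (2^K)%nat with (n' - n)%nat.
      - now apply rsum_sub_sq_le.
      - unfold n', n; simpl; lia. }
    assert (HW := Hw K). fold n n' in HW.
    set (V := rsum n' w - rsum n w) in *.
    assert (p := pow2_gt0 K). set (p2 := 2^K) in *.
    change (2 ^ S K) with (2 * p2).
    set (x := rsum n' (sq f) - rsum n (sq f)) in *.
    replace (rsum n' (sq f)) with (rsum n (sq f) + x) by (unfold x; ring).
    assert (HV : G'^2 * V <= 2 * tau * (G'^2 / (2 * p2))).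
    { replace (2 * tau * (G'^2 / (2 * p2))) with (G'^2 * (tau / p2)) by (field; lra).
      apply Rmult_le_compat_l; [apply pow2_ge_0|].
      apply Rmult_le_reg_l with p2; auto. replace (p2 * (tau / p2)) with tau by (field; lra). easy. }
    assert (HU : G'^2 / (2 * p2) <= 3/4 * (G^2 / p2) + 3/2 * x).
    { apply Rmult_le_reg_l with (2 * p2); [lra|].
      replace (2 * p2 * (G'^2 / (2 * p2))) with (G'^2) by (field; lra).
      replace (2 * p2 * (3 / 4 * (G ^ 2 / p2) + 3 / 2 * x)) with (3/2 * G^2 + 3 * (p2 * x)) by (field; lra).
      (* This square amounts to [G'^2 <= 3/2 G^2 + 3 (G' - G)^2]; [HY] then bounds the last term by
         Cauchy-Schwarz on the block. *)
      assert (0 <= (G - 2 * (G' - G))^2) by apply pow2_ge_0. nra. }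
    assert (tau * (G'^2 / (2 * p2)) <= tau * (3/4 * (G^2 / p2) + 3/2 * x))
      by now apply Rmult_le_compat_l.
    (* Increment and new potential together are at most [8 tau U_(K+1) <= 6 tau U_K + 12 tau x]. *)
    nra.
Qed.

Lemma le_pow2 n : (n <= 2^n)%nat.
Proof. apply Nat.lt_le_incl, Nat.pow_gt_lin_r; lia. Qed.

Lemma hardy w tau f F n : (forall j, 0 <= w j) -> 0 <= tau -> w O <= tau ->
  (forall k, 2^k * (rsum (2^(S k)) w - rsum (2^k) w) <= tau) ->
  (forall m, rsum m (sq f) <= F) ->
  rsum n (fun j => w j * (Cmod (csum (S j) f))^2) <= 12 * tau * F.
Proof.
  intros w0 tau0 Hw0 Hw HF.
  apply Rle_trans with (rsum (2^n) (fun j => w j * (Cmod (csum (S j) f))^2)).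
  - apply rsum_mono; [|apply le_pow2]. intros i; apply Rmult_le_pos; auto; apply pow2_ge_0.
  - assert (H := dyadic_hardy w tau f w0 tau0 Hw0 Hw n).
    assert (tau * rsum (2^n) (sq f) <= tau * F) by now apply Rmult_le_compat_l.
    assert (0 <= tau * ((rsum (2^n) (fun i => Cmod (f i)))^2 / 2^n)).
    { apply Rmult_le_pos; auto. apply Rdiv_le_0_compat; [apply pow2_ge_0|apply pow2_gt0]. }
    lra.
Qed.

(** * Dyadic blocks *)

Lemma sigma_sq alpha k : sigma alpha k ^ 2 =
  rsum (2^(S k)) (fun j => (INR j + 1) * sq alpha j) - rsum (2^k) (fun j => (INR j + 1) * sq alpha j).
Proof.
  assert (p : (2^k <= 2^(S k))%nat) by (apply Nat.pow_le_mono_r; lia).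
  assert (p1 : (0 < 2^(S k))%nat) by (apply Nat.neq_0_lt_0, Nat.pow_nonzero; lia).
  unfold sigma. rewrite sum_n_m_rsum by lia.
  replace (S (2^(S k) - 1)) with (2^(S k))%nat by lia.
  apply pow2_sqrt.
  apply Rge_le, Rge_minus, Rle_ge, rsum_mono; [|easy].
  intros i; apply Rmult_le_pos; [generalize (pos_INR i); lra|apply pow2_ge_0].
Qed.

Lemma sigma_ge0 alpha k : 0 <= sigma alpha k.
Proof. apply sqrt_pos. Qed.

(** On block [k] the weight [j + 1] lies between [2^k] and [2^(S k)]. The lower bound serves the
    upper estimates of the operator, and [sigma_sq_le] the lower ones. *)
Lemma sigma_sq_ge alpha k :
  2^k * (rsum (2^(S k)) (sq alpha) - rsum (2^k) (sq alpha)) <= sigma alpha k ^ 2.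
Proof.
  rewrite sigma_sq, Rmult_minus_distr_l, <- !rsum_scal.
  apply rsum_sub_le; [apply Nat.pow_le_mono_r; lia|].
  intros j [Hj _]. apply Rmult_le_compat_r; [apply sq_ge0|].
  apply le_INR in Hj. rewrite INR_pow2 in Hj. lra.
Qed.

Lemma sigma_sq_le alpha k :
  sigma alpha k ^ 2 <= 2^(S k) * (rsum (2^(S k)) (sq alpha) - rsum (2^k) (sq alpha)).
Proof.
  rewrite sigma_sq, Rmult_minus_distr_l, <- !rsum_scal.
  apply rsum_sub_le; [apply Nat.pow_le_mono_r; lia|].
  intros j [_ Hj]. apply Rmult_le_compat_r; [apply sq_ge0|].
  apply le_INR in Hj. rewrite INR_pow2, S_INR in Hj. lra.
Qed.

(** * Greedy anchors *)

(** Row 0 lies in no dyadic block. It is declared high because it carries the first anchor, so that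
    its error is zero. *)
Definition is_high (alpha : nat -> C) (t : R) (j : nat) : bool :=
  match j with
  | O => true
  | S _ => if Rlt_dec t (sigma alpha (Nat.log2 j)) then true else false
  end.

(* State after row [j]: the current anchor and the number of anchors used so far. *)
Fixpoint greedy (alpha : nat -> C) (t : R) (j : nat) : nat * nat :=
  match j with
  | O => (O, 1%nat)
  | S i =>
      let (a, c) := greedy alpha t i in
      if is_high alpha t (S i) then
        if Rlt_dec (t^2) (INR (S i - a) * (rsum (S (S i)) (sq alpha) - rsum (S a) (sq alpha)))
        then (S i, S c) else (a, c)
      else (a, c)
  end.

Definition anchor alpha t j := fst (greedy alpha t j).
Definition nanchor alpha t j := snd (greedy alpha t j).

Lemma greedy_step alpha t j :
  (is_high alpha t (S j) = true /\ anchor alpha t (S j) = S j /\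
   nanchor alpha t (S j) = S (nanchor alpha t j) /\
   t^2 < INR (S j - anchor alpha t j) *
         (rsum (S (S j)) (sq alpha) - rsum (S (anchor alpha t j)) (sq alpha))) \/
  (anchor alpha t (S j) = anchor alpha t j /\ nanchor alpha t (S j) = nanchor alpha t j /\
   (is_high alpha t (S j) = true ->
    INR (S j - anchor alpha t j) *
      (rsum (S (S j)) (sq alpha) - rsum (S (anchor alpha t j)) (sq alpha)) <= t^2)).
Proof.
  unfold anchor, nanchor; cbn [greedy].
  destruct (greedy alpha t j) as [a c]; cbn [fst snd].
  destruct (is_high alpha t (S j)); [|now right].
  destruct (Rlt_dec _ _) as [H|H]; [now left|right].
  repeat split; intros; lra.
Qed.

Lemma anchor_le alpha t j : (anchor alpha t j <= j)%nat.
Proof.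
  induction j as [|j IH]; [easy|].
  destruct (greedy_step alpha t j) as [[_ [-> _]]|[-> _]]; lia.
Qed.

(** The counter goes up at each change of anchor, so its value determines the anchor. This lets the
    counter index the rank-one pieces of [anchor_op]. *)
Lemma nanchor_mono alpha t i j : (i <= j)%nat ->
  (nanchor alpha t i <= nanchor alpha t j)%nat /\
  (nanchor alpha t i = nanchor alpha t j -> anchor alpha t i = anchor alpha t j).
Proof.
  intros ij; induction ij as [|j ij [IH1 IH2]]; [easy|].
  destruct (greedy_step alpha t j) as [[_ [_ [-> _]]]|[-> [-> _]]]; split; try easy; lia.
Qed.

Lemma nanchor_inj alpha t i j : nanchor alpha t i = nanchor alpha t j ->
  anchor alpha t i = anchor alpha t j.
Proof.
  intros E; destruct (Nat.le_ge_cases i j) as [H|H].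
  - now apply nanchor_mono.
  - symmetry; now apply nanchor_mono.
Qed.

Lemma nanchor_pos alpha t j : (1 <= nanchor alpha t j)%nat.
Proof. apply (nanchor_mono alpha t 0 j); lia. Qed.

(** The share of a high row in the squared norm of [rhaly alpha f - anchor_op alpha t f]. *)
Definition high_error alpha t f j : R :=
  if is_high alpha t j
  then sq alpha j * (Cmod (csum (S j) f - csum (S (anchor alpha t j)) f))^2 else 0.

(** By Cauchy-Schwarz each row since the anchor [a] errs by at most its weight times [J - a] times
    the mass of [f] after [a], which gives the second bound. On a high row that keeps its anchor the
    greedy rule turns it into the first bound; when the anchor moves, the first bound restarts the
    second. *)
Lemma high_error_le alpha t f J :
  let a := anchor alpha t J in
  rsum (S J) (high_error alpha t f) <= t^2 * rsum (S J) (sq f) /\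
  rsum (S J) (high_error alpha t f) <= t^2 * rsum (S a) (sq f) +
    (rsum (S J) (sq alpha) - rsum (S a) (sq alpha)) * INR (J - a) *
    (rsum (S J) (sq f) - rsum (S a) (sq f)).
Proof.
  assert (t2 : 0 <= t^2) by apply pow2_ge_0.
  induction J as [|J IH]; cbv zeta in *.
  - assert (E : rsum 1 (high_error alpha t f) = 0).
    { simpl. unfold high_error. simpl is_high. cbv iota. change (anchor alpha t 0) with O.
      replace (csum 1 f - csum 1 f)%C with (RtoC 0) by ring. rewrite Cmod_0. ring. }
    rewrite E. assert (0 <= rsum 1 (sq f)) by (apply rsum_ge0, sq_ge0).
    change (anchor alpha t 0) with O. rewrite !Rminus_diag. nra.
  - destruct IH as [IH1 IH2].
    assert (aJ := anchor_le alpha t J).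
    assert (MF : rsum (S J) (sq f) <= rsum (S (S J)) (sq f)) by (apply rsum_mono; [apply sq_ge0|lia]).
    assert (MFa : rsum (S (anchor alpha t J)) (sq f) <= rsum (S J) (sq f))
      by (apply rsum_mono; [apply sq_ge0|lia]).
    assert (MWa : rsum (S (anchor alpha t J)) (sq alpha) <= rsum (S J) (sq alpha))
      by (apply rsum_mono; [apply sq_ge0|lia]).
    assert (F1 : t^2 * rsum (S J) (sq f) <= t^2 * rsum (S (S J)) (sq f))
      by now apply Rmult_le_compat_l.
    change (rsum (S (S J)) (high_error alpha t f))
      with (rsum (S J) (high_error alpha t f) + high_error alpha t f (S J)).
    destruct (greedy_step alpha t J) as [[_ [E _]]|[E [_ H]]].
    + assert (Z : high_error alpha t f (S J) = 0).
      { unfold high_error. rewrite E. destruct (is_high _ _ _); [|easy].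
        replace (csum (S (S J)) f - csum (S (S J)) f)%C with (RtoC 0) by ring.
        rewrite Cmod_0. ring. }
      rewrite Z, E, !Rminus_diag. split; lra.
    + set (a := anchor alpha t J) in *.
      assert (N : INR (S J - a) = INR (J - a) + 1)
        by (rewrite <- S_INR; f_equal; lia).
      assert (Na : 0 <= INR (J - a)) by apply pos_INR.
      assert (wJ := sq_ge0 alpha (S J)).
      assert (Hrow : high_error alpha t f (S J) <=
        sq alpha (S J) * INR (S J - a) * (rsum (S (S J)) (sq f) - rsum (S a) (sq f))).
      { unfold high_error. rewrite E. fold a. destruct (is_high _ _ _).
        - rewrite Rmult_assoc. apply Rmult_le_compat_l; [easy|].
          apply (csum_sub_sq_le (S a) (S (S J)) f). lia.
        - apply Rmult_le_pos; [apply Rmult_le_pos|]; try lra; try apply pos_INR. }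
      rewrite E. fold a.
      change (rsum (S (S J)) (sq alpha)) with (rsum (S J) (sq alpha) + sq alpha (S J)) in *.
      set (W := rsum (S J) (sq alpha)) in *. set (Wa := rsum (S a) (sq alpha)) in *.
      set (Fa := rsum (S a) (sq f)) in *. set (F := rsum (S J) (sq f)) in *.
      set (F' := rsum (S (S J)) (sq f)) in *.
      assert (H2 : rsum (S J) (high_error alpha t f) + high_error alpha t f (S J) <=
        t ^ 2 * Fa + (W + sq alpha (S J) - Wa) * INR (S J - a) * (F' - Fa)).
      { assert ((W - Wa) * INR (J - a) * (F - Fa) <= (W - Wa) * INR (S J - a) * (F' - Fa)).
        { apply Rmult_le_compat; try lra; [apply Rmult_le_pos; lra|].
          apply Rmult_le_compat_l; lra. }
        lra. }
      split; [|easy].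
      destruct (is_high alpha t (S J)) eqn:hi.
      * specialize (H eq_refl).
        assert ((W + sq alpha (S J) - Wa) * INR (S J - a) * (F' - Fa) <= t^2 * (F' - Fa)).
        { apply Rmult_le_compat_r; lra. }
        lra.
      (* On a low row length times mass may exceed [t^2], but the row adds no error. *)
      * unfold high_error at 2. rewrite hi. lra.
Qed.

(** Every new anchor closes a stretch whose length times mass exceeds [t^2]; lengths and masses of
    successive stretches add up by [sq_add_le_mul_add]. The first anchor after [J0] is not counted,
    since its stretch may begin before the window. *)
Lemma nanchor_block alpha t J0 J : 0 <= t -> (J0 <= J)%nat ->
  let a := anchor alpha t J in
  let c := INR (nanchor alpha t J) - INR (nanchor alpha t J0) in
  nanchor alpha t J = nanchor alpha t J0 \/
  ((J0 < a)%nat /\ 0 <= c - 1 /\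
   ((c - 1) * t)^2 <= INR (a - S J0) * (rsum (S a) (sq alpha) - rsum (S J0) (sq alpha))).
Proof.
  intros t0 JJ; induction JJ as [|J JJ IH]; cbv zeta in *; [now left|].
  destruct (greedy_step alpha t J) as [[_ [-> [-> H]]]|[-> [-> _]]]; [|easy].
  right. rewrite S_INR. split; [lia|].
  destruct IH as [->|[aJ [c0 IH]]].
  - split; [lra|].
    replace ((INR (nanchor alpha t J0) + 1 - INR (nanchor alpha t J0) - 1) * t) with 0 by ring.
    rewrite pow_i by lia.
    apply Rmult_le_pos; [apply pos_INR|].
    apply Rge_le, Rge_minus, Rle_ge, rsum_mono; [apply sq_ge0|lia].
  - split; [lra|].
    set (a := anchor alpha t J) in *. set (c := INR (nanchor alpha t J)) in *.
    assert (aJ' : (a <= J)%nat) by apply anchor_le.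
    replace ((c + 1 - INR (nanchor alpha t J0) - 1) * t)
      with ((c - INR (nanchor alpha t J0) - 1) * t + t) by ring.
    replace (INR (S J - S J0)) with (INR (a - S J0) + INR (S J - a))
      by (rewrite <- plus_INR; f_equal; lia).
    replace (rsum (S (S J)) (sq alpha) - rsum (S J0) (sq alpha)) with
      ((rsum (S a) (sq alpha) - rsum (S J0) (sq alpha)) +
       (rsum (S (S J)) (sq alpha) - rsum (S a) (sq alpha))) by ring.
    apply sq_add_le_mul_add; try apply pos_INR; try lra; try (now apply Rmult_le_pos);
      apply Rge_le, Rge_minus, Rle_ge, rsum_mono; try apply sq_ge0; lia.
Qed.

(** A high block receives at most [1 + sigma / t] anchors, and [sigma > t] absorbs the 1. *)
Definition cost alpha t k : R := if Rlt_dec t (sigma alpha k) then 2 * sigma alpha k / t else 0.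

Lemma log2_block k j : (2^k <= j < 2^(S k))%nat -> Nat.log2 j = k.
Proof. intros H; apply Nat.log2_unique; [lia|easy]. Qed.

Lemma is_high_block alpha t k j : (2^k <= j < 2^(S k))%nat ->
  is_high alpha t j = if Rlt_dec t (sigma alpha k) then true else false.
Proof.
  intros H. assert (L := log2_block k j H).
  assert (2^k <> 0)%nat by (apply Nat.pow_nonzero; lia).
  destruct j as [|j]; [lia|]. unfold is_high. now rewrite L.
Qed.

(** Row [2^k - 1] is the last one before block [k]. Inside the block lengths are at most [2^k], so
    length times mass is at most [sigma^2], and [nanchor_block] bounds the count. A low block has no
    high row and hence no new anchor. *)
Lemma nanchor_dyadic alpha t k : 0 < t ->
  INR (nanchor alpha t (2^(S k) - 1)) <= INR (nanchor alpha t (2^k - 1)) + cost alpha t k.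
Proof.
  intros t0.
  assert (p : (2^k <> 0)%nat) by (apply Nat.pow_nonzero; lia).
  assert (p' : (2^(S k) = 2 * 2^k)%nat) by reflexivity.
  unfold cost; destruct (Rlt_dec t (sigma alpha k)) as [hi|lo].
  - assert (0 < 2 * sigma alpha k / t) by (apply Rdiv_lt_0_compat; lra).
    destruct (nanchor_block alpha t (2^k - 1) (2^(S k) - 1)) as [->|[aJ [c0 H0]]]; [lra|lia|lra|].
    set (a := anchor alpha t (2^(S k) - 1)) in *.
    assert (aS : (a <= 2^(S k) - 1)%nat) by apply anchor_le.
    set (c := INR (nanchor alpha t (2^(S k) - 1)) - INR (nanchor alpha t (2^k - 1))) in *.
    replace (S (2^k - 1)) with (2^k)%nat in H0 by lia.
    assert (H1 : ((c - 1) * t)^2 <= sigma alpha k ^2).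
    { apply Rle_trans with (2 := sigma_sq_ge alpha k).
      apply Rle_trans with (1 := H0).
      apply Rmult_le_compat.
      - apply pos_INR.
      - apply Rge_le, Rge_minus, Rle_ge, rsum_mono; [apply sq_ge0|lia].
      - rewrite <- INR_pow2. apply le_INR. lia.
      - apply Rplus_le_compat_r, rsum_mono; [apply sq_ge0|lia]. }
    assert (H2 : (c - 1) * t <= sigma alpha k).
    { apply Rsqr_incr_0_var; [|lra]. unfold Rsqr. simpl in H1. lra. }
    assert (c <= 2 * sigma alpha k / t).
    { apply Rmult_le_reg_r with t; [easy|]. field_simplify; lra. }
    unfold c in *; lra.
  - assert (H : forall j, (2^k - 1 <= j)%nat -> (j <= 2^(S k) - 1)%nat ->
      nanchor alpha t j = nanchor alpha t (2^k - 1)).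
    { intros j Hj; induction Hj as [|j Hj IH]; intros Hj'; [easy|].
      destruct (greedy_step alpha t j) as [[h _]|[_ [-> _]]]; [|apply IH; lia].
      rewrite (is_high_block alpha t k) in h by lia.
      now destruct (Rlt_dec t (sigma alpha k)). }
    rewrite H by lia. lra.
Qed.

Lemma cost_ge0 alpha t k : 0 < t -> 0 <= cost alpha t k.
Proof.
  intros t0; unfold cost; destruct (Rlt_dec t (sigma alpha k)); [|lra].
  apply Rlt_le, Rdiv_lt_0_compat; lra.
Qed.

Lemma nanchor_le alpha t K j : 0 < t -> (forall k, (K <= k)%nat -> sigma alpha k <= t) ->
  INR (nanchor alpha t j) <= 1 + rsum K (cost alpha t).
Proof.
  intros t0 HK.
  assert (H : forall M, INR (nanchor alpha t (2^M - 1)) <= 1 + rsum M (cost alpha t)).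
  { induction M as [|M IH].
    (* Only row 0 precedes block 0; its anchor is the summand 1. *)
    - simpl; lra.
    - simpl rsum. generalize (nanchor_dyadic alpha t M t0); lra. }
  apply Rle_trans with (INR (nanchor alpha t (2^j - 1))).
  - apply le_INR, nanchor_mono. generalize (Nat.pow_gt_lin_r 2 j); lia.
  - apply Rle_trans with (1 := H j). apply Rplus_le_compat_l.
    destruct (Nat.le_ge_cases j K) as [jK|Kj].
    + apply rsum_mono; [|easy]. intros; now apply cost_ge0.
    + clear H; induction Kj as [|j Kj IH]; simpl; [lra|].
      unfold cost at 2. specialize (HK j Kj). destruct (Rlt_dec t (sigma alpha j)); lra.
Qed.

(** * Finite rank approximation of Rhaly operators *)

Lemma sq_rhaly alpha f j : sq (rhaly alpha f) j = sq alpha j * (Cmod (csum (S j) f))^2.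
Proof. unfold sq, rhaly. rewrite Cmod_mult. ring. Qed.

Definition anchor_op (alpha : nat -> C) (t : R) : op := fun f j =>
  if is_high alpha t j then Cmult (alpha j) (csum (S (anchor alpha t j)) f) else 0%C.

Definition low_weight (alpha : nat -> C) (t : R) (j : nat) : R :=
  if is_high alpha t j then 0 else sq alpha j.

Lemma low_weight_block alpha t k : 0 <= t ->
  2^k * (rsum (2^(S k)) (low_weight alpha t) - rsum (2^k) (low_weight alpha t)) <= t^2.
Proof.
  intros t0.
  assert (kk : (2^k <= 2^(S k))%nat) by (apply Nat.pow_le_mono_r; lia).
  assert (p := pow2_gt0 k).
  destruct (Rlt_dec t (sigma alpha k)) as [hi|lo].
  - assert (rsum (2^(S k)) (low_weight alpha t) - rsum (2^k) (low_weight alpha t) <=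
      rsum (2^(S k)) (fun _ => 0 * 0) - rsum (2^k) (fun _ => 0 * 0)).
    { apply rsum_sub_le; [easy|]. intros j Hj. unfold low_weight.
      rewrite (is_high_block alpha t k) by easy.
      destruct (Rlt_dec t (sigma alpha k)); lra. }
    rewrite !rsum_scal in H.
    assert (0 <= t^2) by apply pow2_ge_0. nra.
  - apply Rle_trans with (sigma alpha k ^ 2).
    + apply Rle_trans with (2 := sigma_sq_ge alpha k).
      apply Rmult_le_compat_l; [lra|].
      apply rsum_sub_le; [easy|]. intros j _. unfold low_weight.
      generalize (sq_ge0 alpha j); destruct (is_high alpha t j); lra.
    + apply pow_incr; split; [apply sigma_ge0|lra].
Qed.

(** The high rows contribute [t^2 F] and the low rows, by [hardy] with [tau = t^2], [12 t^2 F]; the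
    total 13 is below [4^2]. *)
Lemma opnorm_sub_anchor_op alpha t : 0 <= t ->
  Rbar_le (opnorm (op_sub (rhaly alpha) (anchor_op alpha t))) (4 * t).
Proof.
  intros t0. apply opnorm_le; [lra|]. intros f F n _ F0 HF.
  assert (E : rsum n (sq (op_sub (rhaly alpha) (anchor_op alpha t) f)) =
    rsum n (high_error alpha t f) +
    rsum n (fun j => low_weight alpha t j * (Cmod (csum (S j) f))^2)).
  { rewrite <- rsum_plus. apply rsum_ext. intros j _.
    unfold sq, op_sub, anchor_op, rhaly, high_error, low_weight.
    destruct (is_high alpha t j).
    - replace (alpha j * csum (S j) f - alpha j * csum (S (anchor alpha t j)) f)%C
        with (alpha j * (csum (S j) f - csum (S (anchor alpha t j)) f))%C by ring.
      rewrite Cmod_mult. unfold sq. ring.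
    - replace (alpha j * csum (S j) f - 0)%C with (alpha j * csum (S j) f)%C by ring.
      rewrite Cmod_mult. unfold sq. ring. }
  rewrite E.
  assert (t2 : 0 <= t^2) by apply pow2_ge_0.
  assert (H1 : rsum n (high_error alpha t f) <= t^2 * F).
  { destruct n as [|n]; [simpl rsum; now apply Rmult_le_pos|].
    apply Rle_trans with (1 := proj1 (high_error_le alpha t f n)).
    now apply Rmult_le_compat_l. }
  assert (H2 : rsum n (fun j => low_weight alpha t j * (Cmod (csum (S j) f))^2) <= 12 * t^2 * F).
  { apply hardy; try easy.
    - intros j; unfold low_weight; destruct (is_high alpha t j); [lra|apply sq_ge0].
    - intros k; now apply low_weight_block. }
  assert (0 <= t^2 * F) by now apply Rmult_le_pos. lra.
Qed.

Lemma in_l2_le f g : (forall k, Cmod (f k) <= Cmod (g k)) -> in_l2 g -> in_l2 f.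
Proof.
  intros H Hg. apply (in_l2_bounded f (Series (sq g))). intros n.
  apply Rle_trans with (rsum n (sq g)).
  - apply rsum_le. intros i _. apply pow_incr; split; [apply Cmod_ge_0|easy].
  - apply rsum_le_Series; [apply sq_ge0|easy].
Qed.

Lemma anchor_op_linear alpha t : linear_l2 (anchor_op alpha t).
Proof.
  split; intros; apply functional_extensionality; intros j; unfold anchor_op;
    destruct (is_high alpha t j); rewrite ?csum_plus, ?csum_scal; ring.
Qed.

Lemma is_high_lt alpha t K j : (forall k, (K <= k)%nat -> sigma alpha k <= t) ->
  is_high alpha t j = true -> (j < 2^K)%nat.
Proof.
  intros HK Hj. destruct j as [|j].
  - apply Nat.neq_0_lt_0, Nat.pow_nonzero; lia.
  - apply Nat.nle_gt; intros H. apply Nat.log2_le_pow2 in H; [|lia].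
    specialize (HK _ H). unfold is_high in Hj. destruct (Rlt_dec _ _); [lra|easy].
Qed.

(** All high rows lie below [2^K], so by Cauchy-Schwarz the partial sums that occur have squared
    modulus at most [2^K F]. *)
Lemma anchor_op_bounded alpha t K : in_l2 alpha ->
  (forall k, (K <= k)%nat -> sigma alpha k <= t) -> is_finite (opnorm (anchor_op alpha t)).
Proof.
  intros Ha HK.
  set (A := Series (sq alpha)).
  assert (HA : forall n, rsum n (sq alpha) <= A)
    by (intros n; apply rsum_le_Series; [apply sq_ge0|easy]).
  assert (A0 : 0 <= A) by apply (HA O).
  assert (p := pow2_gt0 K).
  apply opnorm_finite with (sqrt (2^K * A)).
  apply opnorm_le; [apply sqrt_pos|]. intros f F n _ F0 HF.
  rewrite pow2_sqrt by (apply Rmult_le_pos; lra).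
  apply Rle_trans with (rsum n (fun j => 2^K * F * sq alpha j)).
  - apply rsum_le. intros j _. unfold anchor_op, sq at 1.
    assert (a0 := sq_ge0 alpha j).
    destruct (is_high alpha t j) eqn:hi.
    + apply is_high_lt with (1 := HK) in hi.
      rewrite Cmod_mult, Rpow_mult_distr, Rmult_comm.
      apply Rmult_le_compat_r; [easy|].
      apply Rle_trans with (1 := csum_sq_le _ _).
      apply Rmult_le_compat; auto.
      * apply pos_INR.
      * apply rsum_ge0, sq_ge0.
      * rewrite <- INR_pow2. apply le_INR. generalize (anchor_le alpha t j); lia.
    + rewrite Cmod_0, pow_i by lia. apply Rmult_le_pos; [apply Rmult_le_pos; lra|easy].
  - rewrite rsum_scal. replace (2^K * A * F) with (2^K * F * A) by ring.
    apply Rmult_le_compat_l; auto. apply Rmult_le_pos; lra.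
Qed.

Lemma anchor_op_rank alpha t n : in_l2 alpha -> (forall j, (nanchor alpha t j <= n)%nat) ->
  exists v : nat -> nat -> C, (forall i, in_l2 (v i)) /\
    forall f, in_l2 f -> exists c : nat -> C,
      anchor_op alpha t f = (fun k => csum n (fun i => Cmult (c i) (v i k))).
Proof.
  intros Ha Hn.
  (* Piece [i] is [alpha] on the high rows with counter [i + 1]; the shift is there because counters
     start at 1. *)
  exists (fun i j => if andb (is_high alpha t j) (Nat.eqb (nanchor alpha t j) (S i))
                     then alpha j else 0%C).
  split.
  - intros i. apply in_l2_le with alpha; [|easy]. intros j.
    destruct (andb _ _); [lra|]. rewrite Cmod_0. apply Cmod_ge_0.
  - intros f _.
    (* The anchor belonging to a counter value. For a value never reached the choice is arbitrary,
       and the corresponding piece is the zero sequence. *)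
    set (anc := fun c => epsilon (inhabits O)
                  (fun a => exists j, nanchor alpha t j = c /\ anchor alpha t j = a)).
    assert (Hanc : forall j, anc (nanchor alpha t j) = anchor alpha t j).
    { intros j. unfold anc.
      destruct (epsilon_spec (inhabits O)
        (fun a => exists j', nanchor alpha t j' = nanchor alpha t j /\ anchor alpha t j' = a))
        as [j' [E <-]]; [now exists (anchor alpha t j), j|].
      now apply nanchor_inj. }
    exists (fun i => csum (S (anc (S i))) f).
    apply functional_extensionality; intros j. unfold anchor_op.
    destruct (is_high alpha t j); cbn beta iota delta [andb].
    + assert (c1 := nanchor_pos alpha t j). assert (cn := Hn j).
      rewrite (csum_delta n (nanchor alpha t j - 1)).
      * replace (S (nanchor alpha t j - 1)) with (nanchor alpha t j) by lia.
        rewrite Nat.eqb_refl, Hanc. ring.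
      * lia.
      * intros i _ Hi. destruct (Nat.eqb_spec (nanchor alpha t j) (S i)); [lia|ring].
    + symmetry; apply csum_zero. intros; ring.
Qed.

Lemma rhaly_approx_le alpha t K n : in_l2 alpha -> 0 < t ->
  (forall k, (K <= k)%nat -> sigma alpha k <= t) -> 1 + rsum K (cost alpha t) <= INR n ->
  real (approx (rhaly alpha) n) <= 4 * t.
Proof.
  intros Ha t0 HK Hn.
  apply approx_le with (anchor_op alpha t).
  - split; [|split].
    + apply anchor_op_linear.
    + now apply anchor_op_bounded with K.
    + apply anchor_op_rank; [easy|]. intros j. apply INR_le.
      apply Rle_trans with (2 := Hn). now apply nanchor_le.
  - apply opnorm_sub_anchor_op; lra.
Qed.

(** With the zero operator as competitor, [hardy] for the full weight gives [12 t^2 <= (4 t)^2].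
    This yields finiteness of all approximation numbers and the uniform bound that starts the sum
    over levels. *)
Lemma rhaly_bounded alpha t n : 0 <= t -> Cmod (alpha O) <= t ->
  (forall k, sigma alpha k <= t) ->
  is_finite (approx (rhaly alpha) n) /\ real (approx (rhaly alpha) n) <= 4 * t.
Proof.
  intros t0 H0 H. apply approx_le with (fun _ _ => 0%C).
  - split; [|split].
    + split; intros; apply functional_extensionality; intros; ring.
    + apply opnorm_finite with 0. apply opnorm_le; [lra|].
      intros f F m _ F0 _. rewrite pow_i by lia. rewrite Rmult_0_l. right.
      rewrite (rsum_ext m _ (fun _ => 0 * 0)); [rewrite rsum_scal; ring|].
      intros i _. unfold sq. rewrite Cmod_0. ring.
    + exists (fun _ _ => 0%C). split; [intros; apply in_l2_zero|].
      intros f _. exists (fun _ => 0%C). apply functional_extensionality; intros k.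
      symmetry; apply csum_zero; intros; ring.
  - apply opnorm_le; [lra|]. intros f F m _ F0 HF.
    rewrite (rsum_ext m _ (fun j => sq alpha j * (Cmod (csum (S j) f))^2)).
    + apply Rle_trans with (12 * t^2 * F).
      * apply hardy; auto; [apply sq_ge0|apply pow2_ge_0| |].
        -- apply pow_incr; split; [apply Cmod_ge_0|easy].
        -- intros k. apply Rle_trans with (1 := sigma_sq_ge alpha k).
           apply pow_incr; split; [apply sigma_ge0|easy].
      * assert (0 <= t^2 * F) by (apply Rmult_le_pos; [apply pow2_ge_0|easy]). lra.
    + intros j _. rewrite <- sq_rhaly. unfold sq, op_sub. f_equal. f_equal. ring.
Qed.

(** * Summation over dyadic levels *)

Lemma rpow_pos x q : 0 < x -> rpow x q = Rpower x q.
Proof. intros H; unfold rpow; destruct (Rle_dec x 0); [lra|easy]. Qed.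

Lemma rpow_ge0 x q : 0 <= rpow x q.
Proof. unfold rpow; destruct (Rle_dec x 0); [lra|]. apply Rlt_le, exp_pos. Qed.

Lemma rpow_le x y q : 0 <= q -> x <= y -> rpow x q <= rpow y q.
Proof.
  intros q0 xy; destruct (Rle_dec x 0) as [x0|x0].
  - unfold rpow at 1. destruct (Rle_dec x 0); [apply rpow_ge0|easy].
  - rewrite !rpow_pos by lra. apply Rle_Rpower_l; lra.
Qed.

Lemma rpow_mult c x q : 0 < c -> rpow (c * x) q = rpow c q * rpow x q.
Proof.
  intros c0; destruct (Rle_dec x 0) as [x0|x0].
  - assert (c * x <= 0) by nra. unfold rpow.
    destruct (Rle_dec x 0), (Rle_dec (c * x) 0); try easy; ring.
  - assert (0 < c * x) by nra. rewrite !rpow_pos by lra. symmetry; apply Rpower_mult_distr; lra.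
Qed.

Lemma inv_pow2_gt0 J : 0 < / 2^J.
Proof. apply Rinv_0_lt_compat, pow2_gt0. Qed.

Lemma Rpower_inv_pow2 J p : Rpower (/ 2^J) p = (Rpower 2 (- p))^J.
Proof.
  rewrite <- (Rpower_pow J (Rpower 2 (- p))) by apply exp_pos.
  rewrite Rpower_mult, <- (Rpower_pow J 2), <- Rpower_Ropp, Rpower_mult by lra.
  f_equal; ring.
Qed.

(** The levels with [2^-J < s] form a final segment, and there [r^J = (2^-J)^p <= s^p]. By
    telescoping, once such a level is reached the bound keeps [r^N] in reserve; before that the sum
    is zero. *)
Lemma geometric_levels p s N : 0 < p -> 0 < s -> let r := Rpower 2 (- p) in
  (1 - r) * rsum N (fun J => if Rlt_dec (/ 2^J) s then r^J else 0) <= Rpower s p.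
Proof.
  intros p0 s0 r.
  assert (r0 : 0 < r) by apply exp_pos.
  assert (rz : forall J, / 2^J < s -> r^J <= Rpower s p).
  { intros J H. unfold r. rewrite <- Rpower_inv_pow2.
    apply Rle_Rpower_l; [lra|]. split; [apply inv_pow2_gt0|lra]. }
  assert (I : (/ 2^N < s ->
      (1 - r) * rsum N (fun J => if Rlt_dec (/ 2^J) s then r^J else 0) <= Rpower s p - r^N) /\
    (s <= / 2^N -> rsum N (fun J => if Rlt_dec (/ 2^J) s then r^J else 0) = 0)).
  { induction N as [|N [IH1 IH2]].
    - split; [|easy]. intros H; apply rz in H; simpl in *; lra.
    - assert (/ 2^(S N) <= / 2^N).
      { apply Rinv_le_contravar; [apply pow2_gt0|]. apply Rle_pow; [lra|lia]. }
      cbn [rsum]. split; intros H1.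
      + destruct (Rlt_dec (/ 2^N) s) as [H2|H2].
        * specialize (IH1 H2). simpl pow. lra.
        * rewrite IH2 by lra. apply rz in H1. lra.
      + rewrite IH2 by lra. destruct (Rlt_dec (/ 2^N) s); lra. }
  assert (0 < Rpower s p) by apply exp_pos.
  destruct (Rlt_dec (/ 2^N) s) as [H2|H2].
  - apply Rle_trans with (1 := proj1 I H2). assert (0 < r^N) by now apply pow_lt. lra.
  - rewrite (proj2 I) by lra. lra.
Qed.

(** One factor [s] is pulled out and [geometric_levels] is applied with exponent [q - 1 > 0]. *)
Lemma rpow_levels q s N : 1 < q -> let r := Rpower 2 (- (q - 1)) in
  (1 - r) * rsum N (fun J => r^J * (if Rlt_dec (/ 2^J) s then s else 0)) <= rpow s q.
Proof.
  intros q1 r. destruct (Rle_dec s 0) as [s0|s0].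
  - rewrite (rsum_ext N _ (fun _ => 0 * 0)).
    + rewrite rsum_scal. generalize (rpow_ge0 s q); lra.
    + intros J _. generalize (inv_pow2_gt0 J); destruct (Rlt_dec (/ 2^J) s); lra.
  - rewrite rpow_pos by lra.
    replace q with (1 + (q - 1)) at 1 by ring.
    rewrite Rpower_plus, Rpower_1 by lra.
    rewrite (rsum_ext N _ (fun J => s * (if Rlt_dec (/ 2^J) s then r^J else 0)))
      by (intros J _; destruct (Rlt_dec (/ 2^J) s); ring).
    rewrite rsum_scal.
    assert (H := geometric_levels (q - 1) s N). cbv zeta in H. fold r in H.
    replace ((1 - r) * (s * rsum N (fun J => if Rlt_dec (/ 2^J) s then r^J else 0)))
      with (s * ((1 - r) * rsum N (fun J => if Rlt_dec (/ 2^J) s then r^J else 0))) by ring.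
    apply Rmult_le_compat_l; [lra|]. apply H; lra.
Qed.

Lemma geometric_sum_le r N : 0 <= r -> (1 - r) * rsum N (pow r) <= 1.
Proof.
  intros r0. assert (E : (1 - r) * rsum N (pow r) = 1 - r^N).
  { induction N as [|N IH]; cbn [rsum pow]; [ring|]. rewrite Rmult_plus_distr_l, IH; ring. }
  assert (0 <= r^N) by now apply pow_le. lra.
Qed.

Lemma nat_between x : 0 <= x -> exists n, x <= INR n <= x + 1.
Proof.
  intros x0; destruct (nfloor_ex x x0) as [n Hn]. exists (S n). rewrite S_INR; lra.
Qed.

Lemma ex_series_eventually_le s q t : 0 < q -> 0 < t -> ex_series (fun k => rpow (s k) q) ->
  exists K, forall k, (K <= k)%nat -> s k <= t.
Proof.
  intros q0 t0 H. apply ex_series_lim_0, is_lim_seq_spec in H.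
  assert (e : 0 < rpow t q) by (rewrite rpow_pos by easy; apply exp_pos).
  destruct (H (mkposreal _ e)) as [K HK]. exists K. intros k Hk.
  specialize (HK k Hk). simpl in HK. rewrite Rminus_0_r, Rabs_pos_eq in HK by apply rpow_ge0.
  destruct (Rle_dec (s k) t) as [|n]; [easy|].
  assert (rpow t q <= rpow (s k) q) by (apply rpow_le; lra). lra.
Qed.

(* The hypothesis on [a] is used at the levels [t = 2^-J]: there are about [2^J (1 + 2 G_J)]
   indices [n] with [a n > 4 2^-J], where [G_J] sums the [s k] exceeding [2^-J]. *)
Lemma ex_series_of_levels (a s : nat -> R) q A0 : 1 < q ->
  (forall k, 0 <= s k) -> (forall n, a n <= A0) ->
  (forall t K n, 0 < t -> (forall k, (K <= k)%nat -> s k <= t) ->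
     1 + rsum K (fun k => if Rlt_dec t (s k) then 2 * s k / t else 0) <= INR n -> a n <= 4 * t) ->
  ex_series (fun k => rpow (s k) q) -> ex_series (fun n => rpow (a n) q).
Proof.
  intros q1 s0 HA H Hs.
  set (r := Rpower 2 (- (q - 1))).
  assert (r0 : 0 < r) by apply exp_pos.
  assert (r1 : r < 1).
  { unfold r. apply Rlt_le_trans with (Rpower 2 0); [apply Rpower_lt; lra|rewrite Rpower_O; lra]. }
  (* [A0] bounds the terms before level 0; later ones are at most [4 * 2^-J = 8 * 2^-(J+1)]. *)
  set (D := rpow A0 q + rpow 8 q).
  assert (D0 : 0 <= D) by (unfold D; generalize (rpow_ge0 A0 q) (rpow_ge0 8 q); lra).
  set (Sg := Series (fun k => rpow (s k) q)).
  apply ex_series_bounded with (D * ((2 + 2 * Sg) / (1 - r))); [intros; apply rpow_ge0|].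
  intros N.
  (* A cut-off [K] for the finest level [N] serves all coarser levels too. *)
  destruct (ex_series_eventually_le s q (/ 2^N)) as [K HK]; [lra|apply inv_pow2_gt0|easy|].
  set (G := fun J => rsum K (fun k => if Rlt_dec (/ 2^J) (s k) then s k else 0)).
  assert (G0 : forall J, 0 <= G J).
  { intros J; apply rsum_ge0. intros k. destruct (Rlt_dec _ _); [easy|lra]. }
  assert (level : forall J n, (J <= N)%nat -> 2^J * (1 + 2 * G J) <= INR n -> a n <= 4 * / 2^J).
  { intros J n JN Hn. apply (H (/ 2^J) K n).
    - apply inv_pow2_gt0.
    - intros k Hk. apply Rle_trans with (1 := HK k Hk).
      apply Rinv_le_contravar; [apply pow2_gt0|]. apply Rle_pow; [lra|lia].
    - apply Rle_trans with (2 := Hn).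
      rewrite (rsum_ext K _ (fun k => 2 * 2^J * (if Rlt_dec (/ 2^J) (s k) then s k else 0))).
      + rewrite rsum_scal. change (rsum K _) with (G J).
        assert (1 <= 2^J) by (apply pow_R1_Rle; lra). lra.
      + intros k _. destruct (Rlt_dec _ _); [|ring]. field. apply pow_nonzero; lra. }
  (* Here [m] is a cut index beyond which level [J] holds. Going to the next level adds at most
     [2^(J+1) (2 + 2 G_(J+1))] terms, the rounding of the cut index being absorbed by the change
     from 1 to 2. *)
  assert (I : forall J, (J <= N)%nat -> exists m, 2^J * (1 + 2 * G J) <= INR m /\
    rsum m (fun n => rpow (a n) q) <= rsum (S J) (fun i => D * (r^i * (2 + 2 * G i)))).
  { induction J as [|J IH]; intros JN.
    - destruct (nat_between (2^0 * (1 + 2 * G O))) as [m Hm];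
        [simpl; generalize (G0 O); lra|].
      exists m; split; [easy|].
      assert (T := rsum_le_tail 0 m (rpow A0 q) (fun n => rpow (a n) q) (rpow_ge0 _ _)
                    (fun _ => rpow_ge0 _ _) (fun i _ => rpow_le _ _ q ltac:(lra) (HA i))).
      apply Rle_trans with (1 := T). cbn [rsum].
      rewrite Rmult_comm, !Rplus_0_l. simpl pow in *.
      apply Rmult_le_compat; try apply rpow_ge0; try apply pos_INR; [|lra].
      unfold D; generalize (rpow_ge0 8 q); lra.
    - destruct IH as [m [Hm1 Hm2]]; [lia|].
      assert (p := pow2_gt0 J). assert (p' := pow2_gt0 (S J)).
      assert (g := G0 (S J)).
      destruct (nat_between (2^(S J) * (1 + 2 * G (S J)))) as [m' Hm'];
        [apply Rmult_le_pos; lra|].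
      exists m'; split; [easy|].
      assert (T := rsum_le_tail m m' (rpow (4 * / 2^J) q) (fun n => rpow (a n) q) (rpow_ge0 _ _)
                    (fun _ => rpow_ge0 _ _)).
      apply Rle_trans with (rsum m (fun n => rpow (a n) q) + INR m' * rpow (4 * / 2 ^ J) q).
      + apply T. intros n Hn. apply rpow_le; [lra|]. apply level; [lia|].
        apply Rle_trans with (1 := Hm1). apply le_INR; lia.
      + change (rsum (S (S J)) (fun i => D * (r^i * (2 + 2 * G i)))) with
          (rsum (S J) (fun i => D * (r^i * (2 + 2 * G i))) + D * (r^(S J) * (2 + 2 * G (S J)))).
        apply Rplus_le_compat; [easy|].
        assert (E : rpow (4 * / 2^J) q = rpow 8 q * (r^(S J) * / 2^(S J))).
        { replace (4 * / 2^J) with (8 * / 2^(S J)) by (simpl; field; lra).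
          rewrite rpow_mult, (rpow_pos (/ 2^(S J))) by (try lra; apply inv_pow2_gt0).
          f_equal. unfold r. rewrite <- Rpower_inv_pow2.
          rewrite <- (Rpower_1 (/ 2^(S J))) at 3 by apply inv_pow2_gt0.
          rewrite <- Rpower_plus. f_equal; ring. }
        rewrite E.
        assert (L : INR m' <= 2^(S J) * (2 + 2 * G (S J))).
        { assert (1 <= 2^(S J)) by (apply pow_R1_Rle; lra). lra. }
        assert (c8 := rpow_ge0 8 q). assert (rJ : 0 < r^(S J)) by now apply pow_lt.
        assert (iJ := inv_pow2_gt0 (S J)).
        apply Rle_trans with
          (2^(S J) * (2 + 2 * G (S J)) * (rpow 8 q * (r^(S J) * / 2^(S J)))).
        * apply Rmult_le_compat_r; [|easy].
          apply Rmult_le_pos; [easy|]. apply Rmult_le_pos; lra.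
        * replace (2^(S J) * (2 + 2 * G (S J)) * (rpow 8 q * (r^(S J) * / 2^(S J))))
            with (rpow 8 q * (r^(S J) * (2 + 2 * G (S J)))) by (field; lra).
          apply Rmult_le_compat_r.
          -- apply Rmult_le_pos; lra.
          -- unfold D; generalize (rpow_ge0 A0 q); lra. }
  destruct (I N (le_n N)) as [m [Hm1 Hm2]].
  (* The cut index of level [N] is at least [2^N >= N], so the given partial sum is covered. *)
  apply Rle_trans with (rsum m (fun n => rpow (a n) q)).
  { apply rsum_mono; [intros; apply rpow_ge0|]. apply INR_le.
    apply Rle_trans with (2 := Hm1).
    apply Rle_trans with (2^N).
    - rewrite <- INR_pow2. apply le_INR, le_pow2.
    - assert (p := pow2_gt0 N). generalize (G0 N); nra. }
  apply Rle_trans with (1 := Hm2). rewrite rsum_scal.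
  apply Rmult_le_compat_l; [easy|].
  apply Rmult_le_reg_l with (1 - r); [lra|].
  replace ((1 - r) * ((2 + 2 * Sg) / (1 - r))) with (2 + 2 * Sg) by (field; lra).
  rewrite (rsum_ext (S N) _ (fun i => 2 * r^i + 2 * (r^i * G i))) by (intros; ring).
  rewrite rsum_plus, !rsum_scal.
  assert (g1 := geometric_sum_le r (S N) ltac:(lra)).
  (* Interchanging the sums over levels and blocks leaves one instance of [rpow_levels] for each
     [s k]. *)
  assert (g2 : (1 - r) * rsum (S N) (fun i => r^i * G i) <= Sg).
  { rewrite (rsum_ext (S N) _ (fun i => rsum K (fun k =>
      r^i * (if Rlt_dec (/ 2^i) (s k) then s k else 0))))
      by (intros; symmetry; apply rsum_scal).
    rewrite rsum_swap, <- rsum_scal.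
    apply Rle_trans with (rsum K (fun k => rpow (s k) q)).
    - apply rsum_le. intros k _. now apply rpow_levels.
    - apply rsum_le_Series; [intros; apply rpow_ge0|easy]. }
  lra.
Qed.

Lemma schatten_of_sigma alpha q : in_l2 alpha -> 1 < q ->
  ex_series (fun m => rpow (sigma_seq alpha m) q) -> schatten q (rhaly alpha).
Proof.
  intros Ha q1 H.
  assert (Hs : ex_series (fun k => rpow (sigma alpha k) q))
    by (apply (ex_series_incr_1 (fun m => rpow (sigma_seq alpha m) q)); exact H).
  assert (B : exists A, 0 <= A /\ Cmod (alpha O) <= A /\ forall k, sigma alpha k <= A).
  { destruct (ex_series_eventually_le (sigma alpha) q 1) as [K HK]; [lra|lra|easy|].
    exists (Cmod (alpha O) + 1 + rsum K (sigma alpha)).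
    assert (c0 := Cmod_ge_0 (alpha O)).
    assert (S0 : 0 <= rsum K (sigma alpha)) by (apply rsum_ge0, sigma_ge0).
    split; [lra|split; [lra|]]. intros k.
    destruct (Nat.le_gt_cases K k) as [Kk|kK].
    - specialize (HK k Kk); lra.
    - assert (rsum (S k) (sigma alpha) <= rsum K (sigma alpha))
        by (apply rsum_mono; [apply sigma_ge0|easy]).
      assert (0 <= rsum k (sigma alpha)) by (apply rsum_ge0, sigma_ge0).
      simpl in *; lra. }
  destruct B as [A [A0 [HA0 HA]]].
  assert (bd := fun n => rhaly_bounded alpha A n A0 HA0 HA).
  split; [intros n; apply bd|].
  apply (ex_series_of_levels _ (sigma alpha) q (4 * A)); try easy.
  - apply sigma_ge0.
  - intros n; apply bd.
  - intros t K n t0 HK Hn. now apply rhaly_approx_le with K.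
Qed.

(** * Kernel vectors of finite rank operators *)

(* Elimination uses the last unknown as pivot, in an equation [i0] where its coefficient is
   nonzero; the equations other than [i0] are renumbered by [skip]. *)
Lemma homogeneous_solution n (A : nat -> nat -> C) :
  exists x : nat -> C, (exists m, (m <= n)%nat /\ x m <> 0%C) /\
    forall i, (i < n)%nat -> csum (S n) (fun m => Cmult (x m) (A m i)) = 0%C.
Proof.
  revert A; induction n as [|n IH]; intros A.
  - exists (fun _ => 1%C). split; [|lia]. exists O. split; [lia|]. intros E; apply RtoC_inj in E; lra.
  - destruct (classic (exists i, (i < S n)%nat /\ A (S n) i <> 0%C)) as [[i0 [Hi0 Ai0]]|Z].
    + set (skip := fun i => if Nat.ltb i i0 then i else S i).
      set (u := fun m i => (A m i - A m i0 / A (S n) i0 * A (S n) i)%C).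
      destruct (IH (fun m i => u m (skip i))) as [x [[m0 [Hm0 xm0]] Hx]].
      assert (Hu : forall i, (i < S n)%nat -> csum (S n) (fun m => Cmult (x m) (u m i)) = 0%C).
      { intros i Hi. destruct (Nat.lt_total i i0) as [h|[->|h]].
        - rewrite <- (Hx i) by lia. apply csum_ext. intros m _. unfold skip.
          now rewrite (proj2 (Nat.ltb_lt i i0) h).
        - apply csum_zero. intros m _. unfold u. field. easy.
        - rewrite <- (Hx (i - 1)%nat) by lia. apply csum_ext. intros m _. unfold skip.
          rewrite (proj2 (Nat.ltb_ge (i - 1) i0)) by lia. do 2 f_equal; lia. }
      (* The last unknown is obtained by solving equation [i0]. *)
      exists (fun m => if Nat.leb m n then x m
        else Copp (csum (S n) (fun m => Cmult (x m) (A m i0 / A (S n) i0)%C))).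
      split.
      * exists m0. split; [lia|]. now rewrite (proj2 (Nat.leb_le m0 n) Hm0).
      * intros i Hi. rewrite <- (Hu i Hi).
        change (csum (S (S n)) ?h) with (Cplus (csum (S n) h) (h (S n))). cbv beta.
        rewrite (proj2 (Nat.leb_gt (S n) n)) by lia.
        rewrite (csum_ext (S n) _ (fun m => Cmult (x m) (A m i)))
          by (intros m Hm; now rewrite (proj2 (Nat.leb_le m n) ltac:(lia))).
        rewrite (csum_ext (S n) (fun m => Cmult (x m) (u m i)) (fun m =>
          Cplus (Cmult (x m) (A m i))
                (Cmult (Copp (A (S n) i)) (Cmult (x m) (A m i0 / A (S n) i0)%C))))
          by (intros m _; unfold u; ring).
        rewrite csum_plus, csum_scal. ring.
    (* The last unknown occurs in no equation, so the last unit vector is a solution. *)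
    + exists (fun m => if Nat.eqb m (S n) then 1%C else 0%C). split.
      * exists (S n). split; [lia|]. rewrite Nat.eqb_refl. intros E; apply RtoC_inj in E; lra.
      * intros i Hi. apply csum_zero. intros m Hm. destruct (Nat.eqb_spec m (S n)) as [->|]; [|ring].
        destruct (classic (A (S n) i = 0%C)) as [->|ne]; [ring|].
        destruct Z; now exists i.
Qed.

Lemma in_l2_plus f g : in_l2 f -> in_l2 g -> in_l2 (fun k => Cplus (f k) (g k)).
Proof.
  intros Hf Hg. apply (in_l2_bounded _ (2 * Series (sq f) + 2 * Series (sq g))). intros n.
  apply Rle_trans with (rsum n (fun i => 2 * sq f i + 2 * sq g i)).
  - apply rsum_le. intros i _. unfold sq.
    assert (T := Cmod_triangle (f i) (g i)).
    assert (0 <= Cmod (f i + g i)) by apply Cmod_ge_0.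
    assert (0 <= (Cmod (f i) - Cmod (g i))^2) by apply pow2_ge_0.
    assert (Cmod (f i + g i) ^ 2 <= (Cmod (f i) + Cmod (g i))^2) by (apply pow_incr; lra).
    lra.
  - rewrite rsum_plus, !rsum_scal.
    assert (rsum n (sq f) <= Series (sq f)) by (apply rsum_le_Series; [apply sq_ge0|easy]).
    assert (rsum n (sq g) <= Series (sq g)) by (apply rsum_le_Series; [apply sq_ge0|easy]).
    lra.
Qed.

Lemma in_l2_scal c f : in_l2 f -> in_l2 (fun k => Cmult c (f k)).
Proof.
  intros Hf. apply (in_l2_bounded _ (Cmod c ^ 2 * Series (sq f))). intros n.
  rewrite (rsum_ext n _ (fun i => Cmod c ^ 2 * sq f i)).
  - rewrite rsum_scal. apply Rmult_le_compat_l; [apply pow2_ge_0|].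
    apply rsum_le_Series; [apply sq_ge0|easy].
  - intros i _. unfold sq. rewrite Cmod_mult. ring.
Qed.

Lemma linear_l2_csum P n (x : nat -> C) (phi : nat -> nat -> C) : linear_l2 P ->
  (forall m, in_l2 (phi m)) ->
  in_l2 (fun i => csum n (fun m => Cmult (x m) (phi m i))) /\
  P (fun i => csum n (fun m => Cmult (x m) (phi m i))) =
    (fun i => csum n (fun m => Cmult (x m) (P (phi m) i))).
Proof.
  intros [Padd Pscal] Hphi; induction n as [|n [IH1 IH2]].
  - split; [apply in_l2_zero|]. simpl.
    assert (E := Pscal 0%C _ in_l2_zero). cbv beta in E.
    replace (fun _ : nat => Cmult 0 0) with (fun _ : nat => RtoC 0) in E
      by (apply functional_extensionality; intros; ring).
    rewrite E. apply functional_extensionality; intros; ring.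
  - assert (Hn := in_l2_scal (x n) _ (Hphi n)).
    split; [now apply (in_l2_plus _ _ IH1 Hn)|]. simpl.
    rewrite (Padd _ _ IH1 Hn), IH2, (Pscal _ _ (Hphi n)). easy.
Qed.

(** The images of the [n + 1] vectors have [n] coordinates each, so a nontrivial combination of them
    vanishes. The factor [c] leaves room for normalising the combination afterwards. *)
Lemma bdd_rank_le_kernel P n (phi : nat -> nat -> C) : bdd_rank_le P n ->
  (forall m, in_l2 (phi m)) ->
  exists x : nat -> C, (exists m, (m <= n)%nat /\ x m <> 0%C) /\
    forall c : C, P (fun i => csum (S n) (fun m => Cmult (Cmult c (x m)) (phi m i))) = (fun _ => 0%C).
Proof.
  intros [Plin [_ [v [Hv HP]]]] Hphi.
  set (A := fun m => epsilon (inhabits (fun _ : nat => RtoC 0)) (fun c : nat -> C =>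
    P (phi m) = (fun k => csum n (fun i => Cmult (c i) (v i k))))).
  assert (HA : forall m, P (phi m) = (fun k => csum n (fun i => Cmult (A m i) (v i k)))).
  { intros m. unfold A. apply epsilon_spec, HP, Hphi. }
  destruct (homogeneous_solution n A) as [x [Hx0 Hx]].
  exists x. split; [easy|]. intros c.
  rewrite (proj2 (linear_l2_csum P (S n) (fun m => Cmult c (x m)) phi Plin Hphi)).
  apply functional_extensionality; intros k.
  rewrite (csum_ext (S n) _ (fun m =>
    csum n (fun i => Cmult (Cmult c (Cmult (x m) (A m i))) (v i k)))).
  - rewrite csum_swap. apply csum_zero. intros i Hi.
    rewrite (csum_ext (S n) _ (fun m => Cmult (Cmult c (v i k)) (Cmult (x m) (A m i))))
      by (intros; ring).
    rewrite csum_scal, Hx by easy. ring.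
  - intros m _. rewrite HA, <- csum_scal. apply csum_ext. intros; ring.
Qed.

(** * Test sequences *)

(** For [i < 2^r] truncated subtraction gives 0, which is harmless because [profile] vanishes
    there. *)
Definition superblock (r i : nat) : nat := (Nat.log2 i - r) / 3.

(** Two runs of [B] entries of modulus [1 / sqrt (2B)]: each superblock carries a unit vector. *)
Definition profile (r i : nat) : R :=
  let B := (2 ^ (3 * superblock r i + r))%nat in
  if andb (Nat.leb B i) (Nat.ltb i (2 * B)) then / sqrt (2 * INR B)
  else if andb (Nat.leb (4 * B) i) (Nat.ltb i (5 * B)) then - / sqrt (2 * INR B) else 0.

(* On the superblock [B, 8B) with [B = 2^(3k+r)], the sequence equals [X k / sqrt (2B)] on
   [B, 2B) and its opposite on [4B, 5B): its partial sums are constant on [2B, 4B), which is the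
   dyadic block number [3k+r+1], and they vanish at the end of the superblock. *)
Definition test (r : nat) (X : nat -> C) (i : nat) : C := Cmult (X (superblock r i)) (profile r i).

Lemma superblock_eq r k i : (2^(3*k+r) <= i < 8 * 2^(3*k+r))%nat -> superblock r i = k.
Proof.
  intros [H1 H2]. unfold superblock.
  assert (p : (2^(3*k+r) <> 0)%nat) by (apply Nat.pow_nonzero; lia).
  assert (l1 : (3*k+r <= Nat.log2 i)%nat) by (apply Nat.log2_le_pow2; lia).
  assert (l2 : (Nat.log2 i < 3 + (3*k+r))%nat).
  { apply Nat.log2_lt_pow2; [lia|]. rewrite Nat.pow_add_r. exact H2. }
  symmetry. apply Nat.div_unique with (Nat.log2 i - r - 3 * k)%nat; lia.
Qed.

Lemma profile_small r i : (i < 2^r)%nat -> profile r i = 0.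
Proof.
  intros H. unfold profile.
  assert (2^r <= 2^(3 * superblock r i + r))%nat by (apply Nat.pow_le_mono_r; lia).
  rewrite (proj2 (Nat.leb_gt _ i)) by lia. rewrite (proj2 (Nat.leb_gt _ i)) by lia. easy.
Qed.

Lemma csum_const a b (f : nat -> C) c : (a <= b)%nat -> (forall i, (a <= i < b)%nat -> f i = c) ->
  csum b f = Cplus (csum a f) (Cmult (INR (b - a)) c).
Proof.
  intros ab; induction ab as [|b ab IH]; intros H.
  - rewrite Nat.sub_diag. simpl INR. ring.
  - replace (S b - a)%nat with (S (b - a)) by lia. rewrite S_INR, RtoC_plus. simpl csum.
    rewrite IH by (intros; apply H; lia). rewrite (H b) by lia. ring.
Qed.

Lemma rsum_const a b h c : (a <= b)%nat -> (forall i, (a <= i < b)%nat -> h i = c) ->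
  rsum b h = rsum a h + INR (b - a) * c.
Proof.
  intros ab; induction ab as [|b ab IH]; intros H.
  - rewrite Nat.sub_diag. simpl INR. ring.
  - replace (S b - a)%nat with (S (b - a)) by lia. rewrite S_INR. simpl rsum.
    rewrite IH by (intros; apply H; lia). rewrite (H b) by lia. ring.
Qed.

Definition base (r k : nat) : nat := (2^(3*k+r))%nat.

Lemma base_S r k : base r (S k) = (8 * base r k)%nat.
Proof.
  unfold base. replace (3 * S k + r)%nat with (3 + (3 * k + r))%nat by lia.
  now rewrite Nat.pow_add_r.
Qed.

Lemma test_values r X k : let B := base r k in let c := Cmult (X k) (RtoC (/ sqrt (2 * INR B))) in
  (forall i, (B <= i < 2 * B)%nat -> test r X i = c) /\
  (forall i, (2 * B <= i < 4 * B)%nat -> test r X i = 0%C) /\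
  (forall i, (4 * B <= i < 5 * B)%nat -> test r X i = Copp c) /\
  (forall i, (5 * B <= i < 8 * B)%nat -> test r X i = 0%C).
Proof.
  intros B c.
  assert (p : (B <> 0)%nat) by (apply Nat.pow_nonzero; lia).
  assert (E : forall i, (B <= i < 8 * B)%nat -> test r X i =
    Cmult (X k) (RtoC (if andb (Nat.leb B i) (Nat.ltb i (2 * B)) then / sqrt (2 * INR B)
      else if andb (Nat.leb (4 * B) i) (Nat.ltb i (5 * B)) then - / sqrt (2 * INR B) else 0))).
  { intros i Hi. unfold test, profile. now rewrite (superblock_eq r k i). }
  repeat split; intros i Hi; rewrite E by lia;
    destruct (Nat.leb_spec B i); destruct (Nat.ltb_spec i (2 * B));
    destruct (Nat.leb_spec (4 * B) i); destruct (Nat.ltb_spec i (5 * B));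
    try lia; simpl andb; cbv iota; unfold c; rewrite ?RtoC_opp; ring.
Qed.

(** The negative run cancels the positive one, so each superblock starts from partial sum 0 and the
    superblocks do not interact. *)
Lemma test_csum r X k : csum (base r k) (test r X) = 0%C /\
  forall j, (2 * base r k <= j <= 4 * base r k)%nat ->
    csum j (test r X) = Cmult (INR (base r k)) (Cmult (X k) (RtoC (/ sqrt (2 * INR (base r k))))).
Proof.
  assert (Step : forall k, csum (base r k) (test r X) = 0%C ->
    csum (base r (S k)) (test r X) = 0%C /\
    forall j, (2 * base r k <= j <= 4 * base r k)%nat ->
      csum j (test r X) = Cmult (INR (base r k)) (Cmult (X k) (RtoC (/ sqrt (2 * INR (base r k)))))).
  { clear k; intros k H0. destruct (test_values r X k) as [V1 [V2 [V3 V4]]].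
    rewrite base_S.
    set (B := base r k) in *. set (c := Cmult (X k) (RtoC (/ sqrt (2 * INR B)))) in *.
    assert (E2 : csum (2 * B) (test r X) = Cmult (INR B) c).
    { rewrite (csum_const B (2 * B) _ c), H0 by (lia || assumption).
      replace (2 * B - B)%nat with B by lia. ring. }
    assert (E4 : forall j, (2 * B <= j <= 4 * B)%nat -> csum j (test r X) = Cmult (INR B) c).
    { intros j Hj. rewrite (csum_const (2 * B) j _ 0%C), E2; [ring|lia|].
      intros; apply V2; lia. }
    split; [|easy].
    rewrite (csum_const (5 * B) (8 * B) _ 0%C) by (lia || assumption).
    rewrite (csum_const (4 * B) (5 * B) _ (Copp c)) by (lia || assumption).
    rewrite E4 by lia. replace (5 * B - 4 * B)%nat with B by lia. ring. }
  assert (Z : csum (base r k) (test r X) = 0%C).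
  { induction k as [|k IH]; [|now apply Step].
    apply csum_zero. intros i Hi. unfold test. rewrite profile_small by easy. ring. }
  split; [easy|]. now apply Step.
Qed.

Lemma base_gt0 r k : 0 < INR (base r k).
Proof. unfold base. rewrite INR_pow2. apply pow2_gt0. Qed.

Lemma test_norm r X M : rsum (base r M) (sq (test r X)) = rsum M (sq X).
Proof.
  induction M as [|M IH].
  - simpl rsum at 2. rewrite (rsum_const 0 (base r 0) _ 0); [simpl; ring|lia|].
    intros i Hi. unfold sq, test. rewrite profile_small by (unfold base in Hi; simpl in Hi; lia).
    rewrite Cmod_mult, Cmod_0. ring.
  - destruct (test_values r X M) as [V1 [V2 [V3 V4]]]. rewrite base_S.
    assert (p := base_gt0 r M).
    set (B := base r M) in *. set (c := Cmult (X M) (RtoC (/ sqrt (2 * INR B)))) in *.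
    rewrite (rsum_const (5 * B) (8 * B) _ 0);
      [|lia|intros i Hi; unfold sq; rewrite V4, Cmod_0 by easy; ring].
    rewrite (rsum_const (4 * B) (5 * B) _ (Cmod c ^ 2));
      [|lia|intros i Hi; unfold sq; rewrite V3, Cmod_opp by easy; ring].
    rewrite (rsum_const (2 * B) (4 * B) _ 0);
      [|lia|intros i Hi; unfold sq; rewrite V2, Cmod_0 by easy; ring].
    rewrite (rsum_const B (2 * B) _ (Cmod c ^ 2));
      [|lia|intros i Hi; unfold sq; rewrite V1 by easy; ring].
    rewrite IH. replace (5 * B - 4 * B)%nat with B by lia. replace (2 * B - B)%nat with B by lia.
    simpl rsum. unfold sq at 3, c. rewrite Cmod_mult, Cmod_R, Rpow_mult_distr, pow2_abs, pow_inv.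
    rewrite pow2_sqrt by lra. field. lra.
Qed.

(** Of each superblock only [[2B, 4B)] is kept. There the partial sum has squared modulus
    [B/2 * sq X k], and the mass of [alpha] is at least [sigma^2 / (4B)]; the product gives the
    8. *)
Lemma test_image alpha r (X : nat -> C) t M : 0 <= t ->
  (forall k, X k <> 0%C -> t <= sigma alpha (3 * k + r + 1)) ->
  t^2 / 8 * rsum M (sq X) <= rsum (base r M) (sq (rhaly alpha (test r X))).
Proof.
  intros t0 H. induction M as [|M IH].
  - simpl rsum at 1. rewrite Rmult_0_r. apply rsum_ge0, sq_ge0.
  - rewrite base_S. simpl rsum at 1.
    assert (p := base_gt0 r M).
    destruct (test_csum r X M) as [_ Hc].
    set (B := base r M) in *.
    assert (I : t^2 / 8 * sq X M <= rsum (4 * B) (sq (rhaly alpha (test r X)))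
                                  - rsum (2 * B) (sq (rhaly alpha (test r X)))).
    { set (g := INR B / 2 * sq X M).
      assert (E : rsum (4 * B) (fun j => g * sq alpha j) - rsum (2 * B) (fun j => g * sq alpha j) <=
        rsum (4 * B) (sq (rhaly alpha (test r X))) - rsum (2 * B) (sq (rhaly alpha (test r X)))).
      { apply rsum_sub_le; [lia|]. intros j Hj. rewrite sq_rhaly, Hc by lia.
        right. rewrite !Cmod_mult, !Cmod_R, !Rpow_mult_distr, !pow2_abs, pow_inv.
        rewrite pow2_sqrt by lra. unfold g, sq. field. lra. }
      apply Rle_trans with (2 := E). rewrite !rsum_scal, <- Rmult_minus_distr_l.
      destruct (classic (X M = 0%C)) as [Z|nz].
      - unfold g, sq at 1 2. rewrite Z, Cmod_0. lra.
      - specialize (H M nz). assert (s := sigma_sq_le alpha (3 * M + r + 1)).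
        assert (e1 : (2 ^ (3 * M + r + 1) = 2 * B)%nat)
          by (rewrite Nat.add_1_r; reflexivity).
        assert (e2 : (2 ^ S (3 * M + r + 1) = 4 * B)%nat)
          by (rewrite Nat.pow_succ_r', e1; lia).
        rewrite e1, e2 in s. rewrite <- INR_pow2, e2, mult_INR in s. simpl (INR 4) in s.
        assert (t^2 <= sigma alpha (3 * M + r + 1) ^ 2) by now apply pow_incr.
        unfold g. assert (x0 := sq_ge0 X M).
        set (V := rsum (4 * B) (sq alpha) - rsum (2 * B) (sq alpha)) in *.
        replace (INR B / 2 * sq X M * V) with (INR B * V / 2 * sq X M) by field.
        apply Rmult_le_compat_r; lra. }
    assert (rsum B (sq (rhaly alpha (test r X))) <= rsum (2 * B) (sq (rhaly alpha (test r X))))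
      by (apply rsum_mono; [apply sq_ge0|lia]).
    assert (rsum (4 * B) (sq (rhaly alpha (test r X))) <= rsum (8 * B) (sq (rhaly alpha (test r X))))
      by (apply rsum_mono; [apply sq_ge0|lia]).
    lra.
Qed.

Lemma test_partial_norm_le r X n : rsum n (sq (test r X)) <= rsum n (sq X).
Proof.
  rewrite <- (test_norm r X n). apply rsum_mono; [apply sq_ge0|].
  unfold base. apply Nat.le_trans with (1 := le_pow2 n). apply Nat.pow_le_mono_r; lia.
Qed.

(** * Lower bounds for approximation numbers *)

(** A normalised kernel vector of [P] in the span of [n + 1] test sequences has the same image under
    [rhaly alpha - P] as under [rhaly alpha], of squared norm at least [t^2 / 8]. Since [1/9 < 1/8],
    the constant 3 suffices. *)
Lemma approx_rhaly_ge alpha r n l t : is_finite (approx (rhaly alpha) n) ->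
  NoDup l -> length l = S n -> 0 <= t ->
  (forall k, In k l -> t <= sigma alpha (3 * k + r + 1)) ->
  t <= 3 * real (approx (rhaly alpha) n).
Proof.
  intros fin nd len t0 Hl.
  cut (t / 3 <= real (approx (rhaly alpha) n)); [lra|].
  apply le_approx; [easy|]. intros P rho HP rho0 Hrho.
  set (s := fun m => nth m l O).
  set (delta := fun m k => if Nat.eqb k (s m) then RtoC 1 else RtoC 0).
  assert (Hphi : forall m, in_l2 (test r (delta m))).
  { intros m. apply in_l2_bounded with 1. intros N.
    apply Rle_trans with (1 := test_partial_norm_le r _ N).
    assert (E : forall N, rsum N (sq (delta m)) = if Nat.ltb (s m) N then 1 else 0).
    { clear N; induction N as [|N IH]; [easy|]. simpl rsum. rewrite IH. unfold sq, delta.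
      destruct (Nat.eqb_spec N (s m)); destruct (Nat.ltb_spec (s m) N);
        destruct (Nat.ltb_spec (s m) (S N)); try lia; rewrite ?Cmod_1, ?Cmod_0; ring. }
    rewrite E. destruct (Nat.ltb _ _); lra. }
  destruct (bdd_rank_le_kernel P n (fun m => test r (delta m)) HP Hphi)
    as [x [[m0 [Hm0 xm0]] Hx]].
  set (X := fun k => csum (S n) (fun m => Cmult (x m) (delta m k))).
  set (M := S (list_max l)).
  assert (HM : forall k, In k l -> (k < M)%nat).
  { intros k Hk. apply Nat.lt_succ_r.
    exact (proj1 (Forall_forall _ _) (proj1 (list_max_le l _) (le_n _)) k Hk). }
  assert (Xsupp : forall k, X k <> RtoC 0 -> In k l).
  { intros k Hk. destruct (classic (In k l)) as [|no]; [easy|]. destruct Hk.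
    apply csum_zero. intros m Hm. unfold delta.
    destruct (Nat.eqb_spec k (s m)) as [->|]; [|ring].
    destruct no. apply nth_In. lia. }
  (* As [l] has no repetition, the nonzero coefficient of [m0] cannot be cancelled by another
     one. *)
  assert (Xm0 : X (s m0) = x m0).
  { unfold X. rewrite (csum_delta (S n) m0); [|lia|].
    - unfold delta. rewrite Nat.eqb_refl. ring.
    - intros i Hi ne. unfold delta. destruct (Nat.eqb_spec (s m0) (s i)) as [E|]; [|ring].
      destruct ne. symmetry. apply (proj1 (NoDup_nth l O) nd); [lia|lia|exact E]. }
  assert (sl : In (s m0) l) by (apply nth_In; lia).
  set (Z := rsum M (sq X)).
  assert (Z0 : 0 < Z).
  { assert (H1 : rsum (S (s m0)) (sq X) <= Z) by (apply rsum_mono; [apply sq_ge0|now apply HM]).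
    assert (H2 : 0 <= rsum (s m0) (sq X)) by (apply rsum_ge0, sq_ge0).
    assert (H3 : 0 < sq X (s m0)).
    { unfold sq. rewrite Xm0. apply pow_lt, Cmod_gt_0. easy. }
    simpl in H1. lra. }
  set (c := RtoC (/ sqrt Z)).
  set (Y := fun k => Cmult c (X k)).
  assert (sqY : forall k, sq Y k = / Z * sq X k).
  { intros k. unfold sq, Y, c. rewrite Cmod_mult, Cmod_R, Rpow_mult_distr, pow2_abs, pow_inv.
    now rewrite pow2_sqrt by lra. }
  assert (YM : rsum M (sq Y) = 1).
  { rewrite (rsum_ext M _ (fun k => / Z * sq X k)) by (intros; apply sqY).
    rewrite rsum_scal. fold Z. field. lra. }
  assert (Y1 : forall N, rsum N (sq Y) <= 1).
  { intros N. destruct (Nat.le_ge_cases N M) as [NM|MN].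
    - rewrite <- YM. apply rsum_mono; [apply sq_ge0|easy].
    - rewrite (rsum_const M N _ 0), YM; [lra|easy|]. intros k Hk.
      rewrite sqY. destruct (classic (X k = RtoC 0)) as [E|ne].
      + unfold sq. rewrite E, Cmod_0. ring.
      + apply Xsupp, HM in ne. lia. }
  assert (f1 : forall N, rsum N (sq (test r Y)) <= 1).
  { intros N. apply Rle_trans with (1 := test_partial_norm_le r Y N), Y1. }
  assert (PY : P (test r Y) = (fun _ => RtoC 0)).
  { rewrite <- (Hx c). f_equal. apply functional_extensionality; intros i.
    rewrite (csum_ext (S n) _ (fun m =>
      Cmult (Cmult c (profile r i)) (Cmult (x m) (delta m (superblock r i)))))
      by (intros; unfold test; ring).
    rewrite csum_scal. unfold test, Y, X. ring. }
  assert (U := opnorm_le_inv _ rho (test r Y) rho0 Hrho (in_l2_bounded _ 1 f1) f1 (base r M)).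
  rewrite (rsum_ext _ _ (sq (rhaly alpha (test r Y)))) in U.
  - assert (L := test_image alpha r Y t M t0). rewrite YM in L.
    assert (L' : t^2 / 8 <= rho^2).
    { rewrite <- (Rmult_1_r (t^2 / 8)). apply Rle_trans with (2 := U), L.
      intros k Yk. apply Hl, Xsupp. intros E. apply Yk. unfold Y. rewrite E. ring. }
    apply Rsqr_incr_0_var; [|easy]. unfold Rsqr. assert (0 <= t^2) by apply pow2_ge_0. lra.
  - intros i _. unfold sq, op_sub. rewrite PY. do 2 f_equal. ring.
Qed.

(** * Summation of the lower bounds *)

Lemma list_argmin (d : nat -> R) l : l <> nil ->
  exists k, In k l /\ forall j, In j l -> d k <= d j.
Proof.
  induction l as [|a l IH]; intros ne; [easy|].
  destruct l as [|b l].
  - exists a; split; [now left|]. intros j [->|[]]; lra.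
  - destruct IH as [k [Hk Hmin]]; [easy|].
    destruct (Rle_dec (d a) (d k)) as [h|h].
    + exists a; split; [now left|]. intros j [->|Hj]; [lra|]. specialize (Hmin j Hj); lra.
    + exists k; split; [now right|]. intros j [->|Hj]; [lra|now apply Hmin].
Qed.

(* Peel off smallest elements one at a time: this replaces a decreasing rearrangement. *)
Lemma list_sum_le (d b : nat -> R) :
  (forall n l, NoDup l -> length l = S n -> exists k, In k l /\ d k <= b n) ->
  forall n l, NoDup l -> length l = n -> fold_right Rplus 0 (map d l) <= rsum n b.
Proof.
  intros H n; induction n as [|n IH]; intros l nd len.
  - destruct l; [simpl; lra|easy].
  - destruct (H n l nd len) as [k [Hk dk]].
    destruct (in_split k l Hk) as [l1 [l2 ->]].
    assert (nd' := NoDup_remove_1 l1 l2 k nd).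
    rewrite length_app in len; simpl in len.
    assert (I := IH (l1 ++ l2) nd'). rewrite length_app in I. specialize (I ltac:(lia)).
    assert (E : fold_right Rplus 0 (map d (l1 ++ k :: l2)) =
                d k + fold_right Rplus 0 (map d (l1 ++ l2))).
    { clear. induction l1 as [|a l1 IH]; simpl; [easy|]. rewrite IH; ring. }
    rewrite E. simpl. lra.
Qed.

Lemma fold_right_seq (d : nat -> R) M : fold_right Rplus 0 (map d (seq 0 M)) = rsum M d.
Proof.
  assert (A : forall l x, fold_right Rplus 0 (l ++ x :: nil) = fold_right Rplus 0 l + x).
  { induction l as [|a l IH]; intros x; simpl; [ring|]. rewrite IH; ring. }
  induction M as [|M IH]; [easy|].
  rewrite seq_S, map_app. simpl map. rewrite A, IH. easy.
Qed.

Lemma rsum_sigma_le alpha q r M : 0 <= q -> (forall n, is_finite (approx (rhaly alpha) n)) ->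
  rsum M (fun k => rpow (sigma alpha (3 * k + r + 1)) q) <=
  rpow 3 q * rsum M (fun n => rpow (real (approx (rhaly alpha) n)) q).
Proof.
  intros q0 fin.
  rewrite <- fold_right_seq, <- rsum_scal.
  apply list_sum_le; [|apply seq_NoDup|apply length_seq].
  intros n l nd len.
  (* The smallest [sigma] over the [n + 1] chosen blocks is an admissible [t] in
     [approx_rhaly_ge]. *)
  destruct (list_argmin (fun k => sigma alpha (3 * k + r + 1)) l) as [k [Hk Hmin]];
    [now destruct l|].
  exists k; split; [easy|]. rewrite <- rpow_mult by lra. apply rpow_le; [easy|].
  apply approx_rhaly_ge with r l; auto. apply sigma_ge0.
Qed.

Lemma sigma_of_schatten alpha q : 0 <= q -> schatten q (rhaly alpha) ->
  ex_series (fun m => rpow (sigma_seq alpha m) q).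
Proof.
  intros q0 [fin Hser].
  (* The terms for [sigma_(-1)] and [sigma_0] are dropped: the test sequences reach only the blocks
     [3k + r + 1 >= 1], which for [r = 0, 1, 2] are all the others. *)
  apply ex_series_incr_1, ex_series_incr_1; simpl.
  set (A := rpow 3 q * Series (fun n => rpow (real (approx (rhaly alpha) n)) q)).
  assert (HA : forall r M, rsum M (fun k => rpow (sigma alpha (3 * k + r + 1)) q) <= A).
  { intros r M. apply Rle_trans with (1 := rsum_sigma_le alpha q r M q0 fin).
    apply Rmult_le_compat_l; [apply rpow_ge0|].
    apply rsum_le_Series; [intros; apply rpow_ge0|easy]. }
  apply ex_series_bounded with (3 * A); [intros; apply rpow_ge0|]. intros M.
  set (h := fun k => rpow (sigma alpha (S k)) q).
  assert (E : rsum (3 * M) h =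
    rsum M (fun k => rpow (sigma alpha (3 * k + 0 + 1)) q) +
    rsum M (fun k => rpow (sigma alpha (3 * k + 1 + 1)) q) +
    rsum M (fun k => rpow (sigma alpha (3 * k + 2 + 1)) q)).
  { clear. induction M as [|M IH]; [simpl; ring|].
    replace (3 * S M)%nat with (S (S (S (3 * M)))) by lia. cbn [rsum]. rewrite IH. unfold h.
    replace (3 * M + 0 + 1)%nat with (S (3 * M)) by lia.
    replace (3 * M + 1 + 1)%nat with (S (S (3 * M))) by lia.
    replace (3 * M + 2 + 1)%nat with (S (S (S (3 * M)))) by lia. ring. }
  apply Rle_trans with (rsum (3 * M) h).
  - apply rsum_mono; [intros; apply rpow_ge0|lia].
  - rewrite E. generalize (HA 0%nat M) (HA 1%nat M) (HA 2%nat M). lra.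
Qed.

Theorem theorem5p8 (alpha : nat -> C) (q : R) :
  in_l2 alpha -> 1 < q ->
  (schatten q (rhaly alpha) <-> ex_series (fun m => rpow (sigma_seq alpha m) q)).
Proof.
  intros Ha q1; split.
  - apply sigma_of_schatten; lra.
  - now apply schatten_of_sigma.
Qed.
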